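(* Let $(B_H(t))_{t\in\mathbb R}$ be a fractional G-Brownian motion with Hurst index $H$ on a sublinear expectation space $(\Omega,\mathcal H,\hat E)$, and for $n\in\mathbb N$, $n\ge1$, let $$\overline r(n)=\hat E[(B_H(n+1)-B_H(n))B_H(1)],\qquad \underline r(n)=-\hat E[-(B_H(n+1)-B_H(n))B_H(1)]$$ be the upper and lower auto-correlation functions of $B_H(n+1)-B_H(n)$. Then: (i) For $H\in(0,1)$, $$\hat E[(B_H(n+1)-B_H(n))B_H(1)]=\tfrac12\overline\sigma^2\big[(n+1)^{2H}-2n^{2H}+(n-1)^{2H}\big],$$ $$-\hat E[-(B_H(n+1)-B_H(n))B_H(1)]=\tfrac12\underline\sigma^2\big[(n+1)^{2H}-2n^{2H}+(n-1)^{2H}\big].$$ (ii) If $H\in(1/2,1)$, there is long range dependence, i.e. $0<\underline r(n)<\overline r(n)$ for all $n\in\mathbb N$; if $H=1/2$, the increments are uncorrelated, i.e. $\overline r(n)=\underline r(n)=0$; and if $H\in(0,1/2)$, then $\lim_{n\to\infty}\underline r(n)=\lim_{n\to\infty}\overline r(n)=0$.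
   Context: Sublinear expectation space: $\Omega$ is a set, $\mathcal H$ a linear space of real functions on $\Omega$ (random variables) containing constants, stable under $(X_1,\dots,X_n)\mapsto\varphi(X_1,\dots,X_n)$ for $\varphi\in C_{b,Lip}(\mathbb R^n)$, where $C_{b,Lip}(\mathbb R^n)$ here denotes the functions with $|\varphi(x)-\varphi(y)|\le C(1+|x|^m+|y|^m)|x-y|$ for some $C>0$, $m\in\mathbb N$ depending on $\varphi$. The functional $\hat E:\mathcal H\to\mathbb R$ is monotone, constant preserving, sub-additive and positively homogeneous. $L^p_G$ is the completion of $\mathcal H$ (modulo $\hat E[|X|^p]=0$) under $\|X\|_p=(\hat E|X|^p)^{1/p}$; $\hat E$ extends continuously to it. $X_1\stackrel d=X_2$ means $\hat E[\varphi(X_1)]=\hat E[\varphi(X_2)]$ for all $\varphi\in C_{b,Lip}$. $Y$ is independent of $X$ if $\hat E[\varphi(X,Y)]=\hat E\big[\hat E[\varphi(x,Y)]|_{x=X}\big]$ for all such $\varphi$. $X$ is G-normal distributed if $aX+b\bar X\stackrel d=\sqrt{a^2+b^2}\,X$ for all $a,b\ge0$, with $\bar X$ an independent copy of $X$; we write $X\sim N(\{0\},[\underline\sigma^2,\overline\sigma^2])$ with $\overline\sigma^2=\hat E[X^2]$, $\underline\sigma^2=-\hat E[-X^2]$. Throughout $\underline\sigma\le\overline\sigma$ are nonnegative constants. G-Brownian motion $(B_t)_{t\ge0}$: $B_0=0$, and for $t,s>0$ the increment $B_{t+s}-B_t$ is $N(\{0\},[s\underline\sigma^2,s\overline\sigma^2])$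 distributed and independent of $(B_{t_1},\dots,B_{t_n})$ for all $n$ and $t_1,\dots,t_n\in(0,t]$. Two-sided G-Brownian motion: $B(t)=B^{(1)}(t)$ for $t\ge0$, $B(t)=B^{(2)}(-t)$ for $t\le0$, with $B^{(1)},B^{(2)}$ two independent G-Brownian motions. Centered G-Gaussian process: $(X_t)_{t\in\mathbb R}$ such that each $X_t$ is G-normal distributed $N(\{0\},[\underline\sigma_t^2,\overline\sigma_t^2])$ for some $0\le\underline\sigma_t\le\overline\sigma_t$. Fractional G-Brownian motion (fGBm) with Hurst index $H\in(0,1)$: a centered G-Gaussian process $(B_H(t))_{t\in\mathbb R}$ with $B_H(0)=0$ and, for $s,t\in\mathbb R^+$, $\hat E[B_H(s)B_H(t)]=\tfrac12\overline\sigma^2(|t|^{2H}+|s|^{2H}-|t-s|^{2H})$, $-\hat E[-B_H(s)B_H(t)]=\tfrac12\underline\sigma^2(|t|^{2H}+|s|^{2H}-|t-s|^{2H})$. As a standing convention, the fGBm is the one represented by $B_H(t)=C_H^w\int_{\mathbb R}[(t-s)_+^{H-1/2}-(-s)_+^{H-1/2}]\,dB(s)$, with $C_H^w=(2H\sin(\pi H)\Gamma(2H))^{1/2}/\Gamma(H+1/2)$, $B$ a two-sided G-Brownian motion, and the integral of a deterministic $L^2(\mathbb R)$ function being the $L^2_G$-limit of integrals of step functions.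
   Formalization: The formulas in (i) are proved for H ≥ 1/2 or equal lower and upper σ (they fail for H < 1/2 with lower σ < upper σ), and the strict inequalities for H > 1/2 in (ii) assume 0 < lower σ < upper σ (they fail otherwise). *)

(* Defs.v *)
From HB Require Import structures.
From mathcomp Require Import all_boot all_order all_algebra.
From mathcomp Require Import all_classical all_reals all_analysis.

Set Implicit Arguments.
Unset Strict Implicit.
Unset Printing Implicit Defensive.

Import Order.TTheory GRing.Theory Num.Theory.
Import numFieldNormedType.Exports.

Local Open Scope classical_set_scope.
Local Open Scope ring_scope.

(* The test functions written C_{b,Lip}(R^n): locally Lipschitz with a constant
   of polynomial growth.  The norm of 'rV[R]_n is the sup norm; it is equivalent
   to the Euclidean one, so the class of functions is the same. *)
Definition CbLip (R : realType) (n : nat) (phi : 'rV[R]_n -> R) : Prop :=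
  exists (C : R) (m : nat), 0 < C /\
    forall x y : 'rV[R]_n,
      `|phi x - phi y| <= C * (1 + `|x| ^+ m + `|y| ^+ m) * `|x - y|.

(* The functional is total on Omega -> R, but is constrained only on the space
   of random variables [rv]; its values elsewhere are irrelevant. *)
Record sublinear_expectation (R : realType) (Omega : Type) :=
  SublinearExpectation {
    rv : set (Omega -> R);
    expect :> (Omega -> R) -> R;
    rv_cst : forall c : R, rv (fun=> c);
    rvD : forall X Y, rv X -> rv Y -> rv (fun w => X w + Y w);
    rvZ : forall (a : R) X, rv X -> rv (fun w => a * X w);
    rv_comp : forall (n : nat) (X : Omega -> 'rV[R]_n) (phi : 'rV[R]_n -> R),
      (forall i, rv (fun w => X w ord0 i)) -> CbLip phi ->
      rv (fun w => phi (X w));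
    expect_mono : forall X Y, rv X -> rv Y -> (forall w, X w <= Y w) ->
      expect X <= expect Y;
    expect_cst : forall c : R, expect (fun=> c) = c;
    expect_subadd : forall X Y, rv X -> rv Y ->
      expect (fun w => X w + Y w) <= expect X + expect Y;
    expect_poshom : forall (a : R) X, 0 <= a -> rv X ->
      expect (fun w => a * X w) = a * expect X
  }.

Section RandomVectors.
Variables (R : realType).

Definition rvec (Omega : Type) (E : sublinear_expectation R Omega) (n : nat)
    (X : Omega -> 'rV[R]_n) : Prop :=
  forall i, rv E (fun w => X w ord0 i).

Definition vec1 (Omega : Type) (X : Omega -> R) : Omega -> 'rV[R]_1 :=
  fun w => \row_(_ < 1) X w.

Definition eq_dist (Omega1 Omega2 : Type)
    (E1 : sublinear_expectation R Omega1) (E2 : sublinear_expectation R Omega2)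
    (n : nat) (X1 : Omega1 -> 'rV[R]_n) (X2 : Omega2 -> 'rV[R]_n) : Prop :=
  forall phi : 'rV[R]_n -> R, CbLip phi ->
    E1 (fun w => phi (X1 w)) = E2 (fun w => phi (X2 w)).

(* [Y] is independent of [X]; the notion is not symmetric in [X] and [Y]. *)
Definition independent_of (Omega : Type) (E : sublinear_expectation R Omega)
    (m n : nat) (Y : Omega -> 'rV[R]_n) (X : Omega -> 'rV[R]_m) : Prop :=
  forall phi : 'rV[R]_(m + n) -> R, CbLip phi ->
    E (fun w => phi (row_mx (X w) (Y w))) =
    E (fun w => E (fun w' => phi (row_mx (X w) (Y w')))).

(* Being G-normal is a property of the distribution of [X]: the independent copy
   need not live on the space carrying [X], so [X] is realized together with an
   independent copy of itself on a possibly different space. *)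
Definition G_normal (Omega : Type) (E : sublinear_expectation R Omega)
    (X : Omega -> R) : Prop :=
  rv E X /\
  exists (Omega' : Type) (E' : sublinear_expectation R Omega')
         (X' Xbar : Omega' -> R),
    [/\ rv E' X' /\ rv E' Xbar,
        eq_dist E' E (vec1 X') (vec1 X),
        eq_dist E' E' (vec1 Xbar) (vec1 X'),
        independent_of E' (vec1 Xbar) (vec1 X') &
        forall a b : R, 0 <= a -> 0 <= b ->
          eq_dist E' E' (vec1 (fun w => a * X' w + b * Xbar w))
                        (vec1 (fun w => Num.sqrt (a ^+ 2 + b ^+ 2) * X' w))].

(* X ~ N({0}, [vl, vu]), where [vl] and [vu] are the variances. *)
Definition G_normal_var (Omega : Type) (E : sublinear_expectation R Omega)
    (vl vu : R) (X : Omega -> R) : Prop :=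
  [/\ G_normal E X,
      E (fun w => X w ^+ 2) = vu &
      - E (fun w => - X w ^+ 2) = vl].

End RandomVectors.

Section Processes.
Variables (R : realType) (Omega : Type) (E : sublinear_expectation R Omega).
Implicit Types B X : R -> Omega -> R.

Definition at_times X (n : nat) (t : 'I_n -> R) : Omega -> 'rV[R]_n :=
  fun w => \row_i X (t i) w.

(* Only the values [B t] with [0 <= t] matter. *)
Definition G_Brownian (sl su : R) B : Prop :=
  [/\ forall t, 0 <= t -> rv E (B t),
      forall w, B 0 w = 0 &
      forall t s : R, 0 < t -> 0 < s ->
        let dB := fun w => B (t + s) w - B t w in
        G_normal_var E (s * sl ^+ 2) (s * su ^+ 2) dB /\
        forall (n : nat) (u : 'I_n -> R), (forall i, 0 < u i <= t) ->
          independent_of E (vec1 dB) (at_times B u)].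

Definition process_independent_of B2 B1 : Prop :=
  forall (m n : nat) (s : 'I_m -> R) (t : 'I_n -> R),
    (forall i, 0 <= s i) -> (forall j, 0 <= t j) ->
    independent_of E (at_times B2 t) (at_times B1 s).

Definition two_sided B1 B2 : R -> Omega -> R :=
  fun t => if 0 <= t then B1 t else B2 (- t).

(* Independence not being symmetric, either direction is allowed for the two
   halves.  (Requiring both would force sl = su.) *)
Definition two_sided_G_Brownian (sl su : R) B : Prop :=
  exists B1 B2 : R -> Omega -> R,
    [/\ G_Brownian sl su B1, G_Brownian sl su B2,
        process_independent_of B2 B1 \/ process_independent_of B1 B2 &
        B = two_sided B1 B2].

Definition centered_G_Gaussian X : Prop :=
  forall t, exists sl su : R,
    0 <= sl <= su /\ G_normal_var E (sl ^+ 2) (su ^+ 2) (X t).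

(* A step function is given by triples (c, (a, b)) standing for c 1_{]a, b]};
   the intervals may overlap. *)
Definition step := seq (R * (R * R)).

Definition is_step (g : step) : bool := all (fun p => p.2.1 <= p.2.2) g.

Definition step_fun (g : step) (x : R) : R :=
  \sum_(p <- g) p.1 * \1_(`]p.2.1, p.2.2]%classic : set R) x.

Definition step_integral B (g : step) : Omega -> R :=
  fun w => \sum_(p <- g) p.1 * (B p.2.2 w - B p.2.1 w).

Definition step_approx (f : R -> R) (g : nat -> step) : Prop :=
  (forall k, is_step (g k)) /\
  (fun k => \int[@lebesgue_measure R]_x ((step_fun (g k) x - f x) ^+ 2)%:E)%E
    @ \oo --> 0%E.

Definition L2norm (Y : Omega -> R) : R := Num.sqrt (E (fun w => `|Y w| ^+ 2)).

(* [I] represents the integral of the deterministic function [f] against [B],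
   i.e. the limit of the integrals of step functions in the completion of
   [rv E] under [L2norm]. *)
Definition is_G_integral B (f : R -> R) (I : Omega -> R) : Prop :=
  [/\ rv E I,
      exists g, step_approx f g &
      forall g, step_approx f g ->
        (fun k => L2norm (fun w => step_integral B (g k) w - I w))
          @ \oo --> (0 : R)].

(* x_+ ^ a, equal to 0 for x <= 0.  [powR] alone would give 1 at x <= 0 when
   a = 0, i.e. for Hurst index 1/2, and then the kernel below would vanish. *)
Definition pospow (x a : R) : R := if 0 < x then x `^ a else 0.

Definition fBm_kernel (H t s : R) : R :=
  pospow (t - s) (H - 2^-1) - pospow (- s) (H - 2^-1).

Definition Gamma (a : R) : R :=
  Rintegral (@lebesgue_measure R) `]0, +oo[%classic
    (fun x => x `^ (a - 1) * expR (- x)).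

Definition C_Hw (H : R) : R :=
  Num.sqrt (2 * H * sin (pi * H) * Gamma (2 * H)) / Gamma (H + 2^-1).

Definition fBm_cov (H s t : R) : R :=
  `|t| `^ (2 * H) + `|s| `^ (2 * H) - `|t - s| `^ (2 * H).

Definition fGBm (sl su H : R) (BH : R -> Omega -> R) : Prop :=
  [/\ centered_G_Gaussian BH,
      forall w, BH 0 w = 0,
      forall s t, 0 <= s -> 0 <= t ->
        E (fun w => BH s w * BH t w) = 2^-1 * su ^+ 2 * fBm_cov H s t /\
        - E (fun w => - (BH s w * BH t w)) = 2^-1 * sl ^+ 2 * fBm_cov H s t &
      exists B, two_sided_G_Brownian sl su B /\
        forall t, exists2 I, is_G_integral B (fBm_kernel H t) I &
          forall w, BH t w = C_Hw H * I w].

Definition upper_autocorr (BH : R -> Omega -> R) (n : nat) : R :=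
  E (fun w => (BH n.+1%:R w - BH n%:R w) * BH 1 w).

Definition lower_autocorr (BH : R -> Omega -> R) (n : nat) : R :=
  - E (fun w => - ((BH n.+1%:R w - BH n%:R w) * BH 1 w)).

End Processes.

(* Main.v *)
Require Import Defs.
From mathcomp Require Import all_boot all_order all_algebra.
From mathcomp Require Import all_classical all_reals all_analysis.
From mathcomp Require Import measurable_realfun ring lra.
Import Order.TTheory GRing.Theory Num.Theory.
Import numFieldNormedType.Exports.
Local Open Scope classical_set_scope.
Local Open Scope ring_scope.

Set Implicit Arguments.
Unset Strict Implicit.
Unset Printing Implicit Defensive.

(** Put [G x = su^2 max(x, 0) + sl^2 min(x, 0)].  The core is the sublinear
    isometry [E (I_f I_h) = \int G (f h)] for integrals of deterministic
    functions: on a common partition it follows by conditioning on the past one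
    increment at a time, since an increment has zero upper and lower mean, and
    it passes to L^2 limits.  When [f h >= 0] (or [sl = su]) the right-hand side
    is [su^2 \int f h], which is bilinear.  For [H >= 1/2] the kernels and their
    increments are nonnegative, so the autocorrelations are differences of
    covariances; the value of the normalizing constant [C_Hw H] is never needed,
    because the assumed covariance determines [C_Hw H ^ 2 \int k_s k_t].  For
    [H < 1/2] the increment [k_(n+1) - k_n] tends to 0 and, left of 1, is dominated
    by [k_2 - k_1], so the limits follow by dominated convergence. *)

(** The condition [2^-1 <= H \/ sl = su] of the first claim comes from a sign. For [H < 2^-1] the
    function [(k_(n+1) - k_n) k_1] is positive left of 0 and negative on ]0, 1[. The isometry
    weights its positive part by [su ^+ 2] and its negative part by [sl ^+ 2], so for [sl < su] the
    upper autocorrelation is strictly larger than the closed formula. The covariances assumed in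
    [fGBm] do not conflict with this: for [s, t >= 0] the product [k_s k_t] is nonnegative whatever
    [H] is, and it is only the difference of two such products that changes sign. The bounds
    [0 < sl < su] in the claim on long range dependence have a similar source: where the formula
    holds, the lower and upper autocorrelations are [sl ^+ 2] and [su ^+ 2] times one positive
    number. *)

(** * Lipschitz functions and their products as test functions *)

Definition lipschitz_fun (R : realType) (n : nat) (f : 'rV[R]_n -> R) : Prop :=
  exists2 L, 0 <= L & forall x y, `|f x - f y| <= L * `|x - y|.

Lemma lipschitz_coord (R : realType) n (i : 'I_n) :
  lipschitz_fun (fun z : 'rV[R]_n => z ord0 i).
Proof.
exists 1 => // x y; rewrite mul1r.
have -> : x ord0 i - y ord0 i = (x - y) ord0 i by rewrite !mxE.
rewrite [leRHS]mx_normrE.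
exact: (le_bigmax _ (fun ij => `|(x - y) ij.1 ij.2|) (ord0, i)).
Qed.

Lemma lipschitzD (R : realType) n (f g : 'rV[R]_n -> R) :
  lipschitz_fun f -> lipschitz_fun g -> lipschitz_fun (fun z => f z + g z).
Proof.
move=> [L L0 fL] [M M0 gM]; exists (L + M); first exact: addr_ge0.
move=> x y; rewrite opprD addrACA mulrDl.
by apply: le_trans (ler_normD _ _) _; apply: lerD.
Qed.

Lemma lipschitzZ (R : realType) n (a : R) (f : 'rV[R]_n -> R) :
  lipschitz_fun f -> lipschitz_fun (fun z => a * f z).
Proof.
move=> [L L0 fL]; exists (`|a| * L); first exact: mulr_ge0.
by move=> x y; rewrite -mulrBr normrM -mulrA ler_wpM2l.
Qed.

Lemma lipschitzB (R : realType) n (f g : 'rV[R]_n -> R) :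
  lipschitz_fun f -> lipschitz_fun g -> lipschitz_fun (fun z => f z - g z).
Proof.
move=> lf lg; have := lipschitzD lf (lipschitzZ (-1) lg).
by congr lipschitz_fun; apply/funext => z; rewrite mulN1r.
Qed.

Lemma lipschitz_sum (R : realType) n (I : Type) (r : seq I)
    (f : I -> 'rV[R]_n -> R) : (forall i, lipschitz_fun (f i)) ->
  lipschitz_fun (fun z => \sum_(i <- r) f i z).
Proof.
move=> lf; elim: r => [|i r ih].
  exists 0 => // x y; rewrite !big_nil subrr normr0 mul0r //.
have := lipschitzD (lf i) ih.
by congr lipschitz_fun; apply/funext => z; rewrite big_cons.
Qed.

Lemma CbLip_lipschitz (R : realType) n (f : 'rV[R]_n -> R) :
  lipschitz_fun f -> CbLip f.
Proof.
move=> [L L0 fL]; exists (L + 1), 0%N; split; first by rewrite ltr_wpDl.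
move=> x y; rewrite !expr0; apply: le_trans (fL x y) _.
apply: ler_wpM2r => //; lra.
Qed.

(** A product of two Lipschitz functions has a Lipschitz constant of linear growth, hence the
    exponent 1. Products of two linear forms in the increments are the test functions on which the
    isometry rests. *)
Lemma CbLip_lipschitzM (R : realType) n (f g : 'rV[R]_n -> R) :
  lipschitz_fun f -> lipschitz_fun g -> CbLip (fun z => f z * g z).
Proof.
move=> [L L0 fL] [M M0 gM].
have growth (h : 'rV[R]_n -> R) K : 0 <= K ->
    (forall x y, `|h x - h y| <= K * `|x - y|) ->
    forall x, `|h x| <= (`|h 0| + K) * (1 + `|x|).
  move=> K0 hK x; have := hK x 0; rewrite subr0 => hx.
  have : `|h x| <= `|h x - h 0| + `|h 0|.
    by rewrite -[X in `|X| <= _](subrK (h 0)) ler_normD.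
  have := mulr_ge0 K0 (normr_ge0 x); have := mulr_ge0 (normr_ge0 (h 0)) (normr_ge0 x).
  lra.
have fg := growth f L L0 fL; have gg := growth g M M0 gM.
exists ((`|f 0| + L) * M + (`|g 0| + M) * L + 1), 1%N; split.
  by rewrite ltr_wpDl// addr_ge0// mulr_ge0// addr_ge0.
move=> x y; rewrite !expr1.
have -> : f x * g x - f y * g y = f x * (g x - g y) + g y * (f x - f y) by ring.
apply: le_trans (ler_normD _ _) _; rewrite !normrM.
have h1 : `|f x| * `|g x - g y| <=
    (`|f 0| + L) * (1 + `|x|) * (M * `|x - y|) by exact: ler_pM.
have h2 : `|g y| * `|f x - f y| <=
    (`|g 0| + M) * (1 + `|y|) * (L * `|x - y|) by exact: ler_pM.
apply: le_trans (lerD h1 h2) _.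
have -> : (`|f 0| + L) * (1 + `|x|) * (M * `|x - y|) +
    (`|g 0| + M) * (1 + `|y|) * (L * `|x - y|)
  = ((`|f 0| + L) * M * (1 + `|x|) + (`|g 0| + M) * L * (1 + `|y|)) * `|x - y| by ring.
apply: ler_wpM2r => //.
have a0 : 0 <= (`|f 0| + L) * M by rewrite mulr_ge0// addr_ge0.
have b0 : 0 <= (`|g 0| + M) * L by rewrite mulr_ge0// addr_ge0.
have := mulr_ge0 a0 (normr_ge0 y); have := mulr_ge0 b0 (normr_ge0 x).
have := normr_ge0 x; have := normr_ge0 y; lra.
Qed.

(** * Sublinear expectations and G-normal variables *)

Section Expectation.
Variables (R : realType) (Omega : Type) (E : sublinear_expectation R Omega).
Implicit Types X Y : Omega -> R.

Lemma rvN X : rv E X -> rv E (fun w => - X w).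
Proof. by move=> /(rvZ (-1)); congr rv; apply/funext => w; rewrite mulN1r. Qed.

Lemma rvB X Y : rv E X -> rv E Y -> rv E (fun w => X w - Y w).
Proof. by move=> rX /rvN; exact: rvD. Qed.

Lemma rv_sum (I : Type) (r : seq I) (X : I -> Omega -> R) :
  (forall i, rv E (X i)) -> rv E (fun w => \sum_(i <- r) X i w).
Proof.
move=> rX; elim: r => [|i r ih].
  by have := rv_cst E 0; congr rv; apply/funext => w; rewrite big_nil.
by have := rvD (rX i) ih; congr rv; apply/funext => w; rewrite big_cons.
Qed.

(** The axioms give closure under test functions of a random vector only, so the product is read as
    the test function [x * y] of the pair [Z]. *)
Lemma rvM X Y : rv E X -> rv E Y -> rv E (fun w => X w * Y w).
Proof.
move=> rX rY.
pose Z w : 'rV[R]_2 := \row_i (if i == ord0 then X w else Y w).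
have rZ i : rv E (fun w => Z w ord0 i).
  by rewrite /Z; under eq_fun do rewrite mxE; case: (i == ord0).
have := rv_comp rZ (CbLip_lipschitzM (lipschitz_coord R ord0)
                                     (lipschitz_coord R (lift ord0 ord0))).
by congr rv; apply/funext => w; rewrite !mxE.
Qed.

Lemma expectDc (c : R) X : rv E X -> E (fun w => c + X w) = c + E X.
Proof.
move=> rX; apply/eqP; rewrite eq_le; apply/andP; split.
  by have := expect_subadd (rv_cst E c) rX; rewrite expect_cst.
(* The reverse inequality is subadditivity again, applied to [- c] and [c + X]. *)
have := expect_subadd (rv_cst E (- c)) (rvD (rv_cst E c) rX).
rewrite expect_cst; under eq_fun do rewrite addKr.
lra.
Qed.

Lemma expect0 : E (fun=> 0) = 0. Proof. exact: expect_cst. Qed.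

Definition zero_mean X := [/\ rv E X, E X = 0 & E (fun w => - X w) = 0].

(** Subadditivity bounds [E Z] and [E (- Z)] above by 0 for [Z = X + Y], and
    [0 = E (Z - Z) <= E Z + E (- Z)] then forces both to be 0. *)
Lemma zero_meanD X Y : zero_mean X -> zero_mean Y ->
  zero_mean (fun w => X w + Y w).
Proof.
move=> [rX X0 NX0] [rY Y0 NY0]; have rXY := rvD rX rY.
have le1 := expect_subadd rX rY.
have := expect_subadd (rvN rX) (rvN rY).
under eq_fun do rewrite -opprD.
have := expect_subadd rXY (rvN rXY); under eq_fun do rewrite subrr.
rewrite expect0 => h1 h2; split=> //; lra.
Qed.

Lemma zero_meanZ (a : R) X : zero_mean X -> zero_mean (fun w => a * X w).
Proof.
move=> [rX X0 NX0]; split; first exact: rvZ.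
  have [a0|a0] := leP 0 a; first by rewrite expect_poshom// X0 mulr0.
  under eq_fun do rewrite -mulrNN.
  by rewrite expect_poshom ?NX0 ?mulr0 ?oppr_ge0 ?ltW//; exact: rvN.
have [a0|a0] := leP 0 a.
  under eq_fun do rewrite -mulrN.
  by rewrite expect_poshom ?NX0 ?mulr0//; exact: rvN.
under eq_fun do rewrite -mulNr.
by rewrite expect_poshom ?X0 ?mulr0 ?oppr_ge0 ?ltW.
Qed.

Lemma zero_mean_sum (I : Type) (r : seq I) (X : I -> Omega -> R) :
  (forall i, zero_mean (X i)) -> zero_mean (fun w => \sum_(i <- r) X i w).
Proof.
move=> zX; elim: r => [|i r ih].
  split; under eq_fun do rewrite big_nil ?oppr0; [exact: rv_cst|exact: expect0..].
by have := zero_meanD (zX i) ih; congr zero_mean; apply/funext => w; rewrite big_cons.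
Qed.

Lemma expectD_zero_mean X Y : rv E X -> zero_mean Y ->
  E (fun w => X w + Y w) = E X.
Proof.
move=> rX [rY Y0 NY0]; apply/eqP; rewrite eq_le; apply/andP; split.
  by have := expect_subadd rX rY; rewrite Y0 addr0.
have := expect_subadd (rvD rX rY) (rvN rY); rewrite NY0 addr0.
by under eq_fun do rewrite addrK.
Qed.

End Expectation.

(** Twice the usual generating function of the G-normal law with variances [vl] and [vu];
    [Num.min x 0] is minus the negative part of [x]. *)
Definition Gfun (R : realType) (vl vu x : R) : R :=
  vu * Num.max x 0 + vl * Num.min x 0.

Lemma Gfun0 (R : realType) (vl vu : R) : Gfun vl vu 0 = 0.
Proof. by rewrite /Gfun maxxx minxx !mulr0 addr0. Qed.

Lemma GfunE (R : realType) (vl vu x : R) :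
  Gfun vl vu x = if 0 <= x then vu * x else vl * x.
Proof.
rewrite /Gfun; case: ifPn => [x0|]; first by rewrite max_l// min_r// mulr0 addr0.
by rewrite -ltNge => /ltW x0; rewrite max_r// min_l// mulr0 add0r.
Qed.

Lemma GfunZ (R : realType) (s vl vu x : R) :
  Gfun (s * vl) (s * vu) x = Gfun vl vu x * s.
Proof. by rewrite /Gfun; ring. Qed.

Section GNormal.
Variables (R : realType) (Omega : Type) (E : sublinear_expectation R Omega).

(** Let [m] be the mean of [e * X']. Independence makes the mean of [e * (X' + Xbar)] equal to
    [2 * m], while stability with [a = b = 1] makes it [sqrt 2 * m]; hence [m = 0]. The sign of [e]
    covers the upper and the lower mean at once. *)
Lemma G_normal_zero_mean X : G_normal E X -> zero_mean E X.
Proof.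
move=> [rX]; case=> O1 []E' []X' []Xbar [[rX' rXb] dX' dXb iX sX].
have vecE (T : Type) (Y : T -> R) (e : R) :
    (fun w => e * vec1 Y w ord0 ord0) = (fun w => e * Y w).
  by apply/funext => w; rewrite mxE.
have le1 (e : R) n (i : 'I_n) : lipschitz_fun (fun z : 'rV[R]_n => e * z ord0 i).
  by apply: lipschitzZ; exact: lipschitz_coord.
have mean (e : R) : E' (fun w => e * X' w) = 0.
  have eXb : E' (fun w => e * Xbar w) = E' (fun w => e * X' w).
    by have := dXb _ (CbLip_lipschitz (le1 e 1%N ord0)); rewrite !vecE.
  have := iX _ (CbLip_lipschitz
    (lipschitzD (le1 e _ (lshift 1 ord0)) (le1 e _ (rshift 1 ord0)))).
  rewrite /vec1; under eq_fun do rewrite row_mxEl row_mxEr !mxE.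
  under [X in _ = E' X]eq_fun => w.
    under eq_fun do rewrite row_mxEl row_mxEr !mxE.
    rewrite (expectDc _ (rvZ e rXb)) eXb addrC.
    over.
  rewrite (expectDc _ (rvZ e rX')) => h1.
  have := sX 1 1 ler01 ler01 _ (CbLip_lipschitz (le1 e 1%N ord0)).
  rewrite !vecE; under eq_fun do rewrite !mul1r mulrDr.
  rewrite h1; under [in RHS]eq_fun do rewrite mulrCA.
  rewrite (expect_poshom (sqrtr_ge0 _) (rvZ e rX')) !expr1n.
  move: (E' _) => m h2.
  have : (2 - Num.sqrt (1 + 1)) * m = 0 by rewrite mulrBl -h2; ring.
  move/eqP; rewrite mulf_eq0 => /orP[|/eqP//].
  rewrite subr_eq0 => /eqP s2; have := sqr_sqrtr (addr_ge0 (@ler01 R) (@ler01 R)).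
  by rewrite -s2; lra.
have meanX (e : R) : E (fun w => e * X w) = 0.
  by have := dX' _ (CbLip_lipschitz (le1 e 1%N ord0)); rewrite !vecE mean => <-.
split=> //.
  by rewrite -[RHS](meanX 1); congr (E _); apply/funext => w; rewrite mul1r.
by rewrite -[RHS](meanX (-1)); congr (E _); apply/funext => w; rewrite mulN1r.
Qed.

Lemma G_normal_var_zero_mean vl vu X :
  G_normal_var E vl vu X -> zero_mean E X.
Proof. by case=> /G_normal_zero_mean. Qed.

Lemma G_normal_var_sq vl vu X (e : R) : G_normal_var E vl vu X ->
  E (fun w => e * X w ^+ 2) = Gfun vl vu e.
Proof.
move=> [[rX _] <- <-]; have rX2 : rv E (fun w => X w ^+ 2).
  by under eq_fun do rewrite expr2; exact: rvM.
rewrite GfunE; case: ifPn => [e0|]; first by rewrite expect_poshom// mulrC.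
rewrite -ltNge => /ltW e0; under eq_fun do rewrite -mulrNN.
by rewrite expect_poshom ?oppr_ge0//; [ring|exact: rvN].
Qed.

End GNormal.

(** * Sums of increments of G-Brownian motion *)

Section Increments.
Variables (R : realType) (Omega : Type) (E : sublinear_expectation R Omega).
Variables (sl su : R).
Local Notation G := (Gfun (sl ^+ 2) (su ^+ 2)).

Definition incsum (B : R -> Omega -> R) (t v : nat -> R) (n : nat) : Omega -> R :=
  fun w => \sum_(i < n) v i * (B (t i.+1) w - B (t i) w).

Definition incr_upto (t : nat -> R) (n : nat) :=
  forall i j, (i < j <= n)%N -> t i < t j.

Lemma incr_uptoW t n : incr_upto t n.+1 -> incr_upto t n.
Proof. by move=> h i j /andP[ij jn]; apply: h; rewrite ij (leq_trans jn). Qed.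

Lemma incr_upto_le t n i j : incr_upto t n -> (i <= j <= n)%N -> t i <= t j.
Proof.
move=> h /andP[]; rewrite leq_eqVlt => /orP[/eqP->//|ij jn].
by apply/ltW/h; rewrite ij.
Qed.

Lemma incr_upto_gt0 t n i : 0 < t 0%N -> incr_upto t n -> (i <= n)%N -> 0 < t i.
Proof. by move=> t0 h i_n; apply: lt_le_trans t0 (incr_upto_le h _). Qed.

Lemma rv_incsum B t v n : (forall s, 0 <= s -> rv E (B s)) ->
  (forall i, (i <= n)%N -> 0 <= t i) -> rv E (incsum B t v n).
Proof.
move=> rB t0; apply: rv_sum => i; apply: rvZ.
by apply: rvB; apply: rB; apply: t0 => //; exact: ltnW.
Qed.

Lemma zero_mean_incsum B t v n : G_Brownian E sl su B -> 0 < t 0%N ->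
  incr_upto t n -> zero_mean E (incsum B t v n).
Proof.
move=> [_ _ nB] t0 ti; apply: zero_mean_sum => i; apply: zero_meanZ.
have ti0 : 0 < t i by apply: (incr_upto_gt0 t0 ti); exact: ltnW.
have dt : 0 < t i.+1 - t i by rewrite subr_gt0; apply: ti; rewrite ltnSn ltn_ord.
have [+ _] := nB _ _ ti0 dt; rewrite [t i + _]addrC subrK.
exact: G_normal_var_zero_mean.
Qed.

(** [incsum] seen as a function of a vector of path values, the form that independence requires;
    [c i] is the coordinate that carries the value at the grid point [i]. *)
Definition lincoord m (v : nat -> R) n (c : nat -> 'I_m) (z : 'rV[R]_m) : R :=
  \sum_(i < n) v i * (z ord0 (c i.+1) - z ord0 (c i)).

Lemma lipschitz_lincoord m v n (c : nat -> 'I_m) :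
  lipschitz_fun (lincoord v n c).
Proof.
apply: lipschitz_sum => i; apply: lipschitzZ.
by apply: lipschitzB; exact: lipschitz_coord.
Qed.

(** With the past frozen, the product is a constant plus a multiple of [xi ^+ 2] plus a multiple of
    [xi], where [xi] is the last increment. The constant leaves [E], the square contributes
    [G (v n * v' n)] times the length of the interval, and the linear term has zero mean. What is
    left outside is the product of the shorter sums, to which the induction hypothesis applies. *)
Lemma expect_incsumM B t v v' n : G_Brownian E sl su B -> 0 < t 0%N ->
  incr_upto t n ->
  E (fun w => incsum B t v n w * incsum B t v' n w) =
  \sum_(i < n) G (v i * v' i) * (t i.+1 - t i).
Proof.
move=> bB t0; have [rB _ nB] := bB.
elim: n => [|n ih] ti.
  rewrite big_ord0 -[RHS](expect0 E); congr (E _).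
  by apply/funext => w; rewrite /incsum big_ord0 mul0r.
have ti' := incr_uptoW ti.
have tn0 : 0 < t n by apply: (incr_upto_gt0 t0 ti); rewrite leqnSn.
have dt : 0 < t n.+1 - t n by rewrite subr_gt0; apply: ti; rewrite !leqnn.
have [] := nB _ _ tn0 dt; rewrite [t n + _]addrC subrK.
set xi := (fun w => _ - _) => nxi ixi.
have zxi := G_normal_var_zero_mean nxi.
have rxi : rv E xi by case: zxi.
have tpos (i : 'I_n.+1) : 0 < t i <= t n.
  have i_n : (i <= n)%N by rewrite -ltnS.
  by rewrite (incr_upto_gt0 t0 ti' i_n) (incr_upto_le ti') ?i_n ?leqnn.
have {ixi} := ixi n.+1 (fun i : 'I_n.+1 => t i) tpos.
pose c i : 'I_(n.+1 + 1) := lshift 1 (inord i).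
pose f a (z : 'rV[R]_(n.+1 + 1)) := lincoord a n c z + a n * z ord0 (rshift n.+1 ord0).
have lf a : lipschitz_fun (f a).
  apply: lipschitzD; first exact: lipschitz_lincoord.
  by apply: lipschitzZ; exact: lipschitz_coord.
move=> /(_ _ (CbLip_lipschitzM (lf v) (lf v'))).
have fE a w w' : f a (row_mx (at_times B (fun i : 'I_n.+1 => t i) w) (vec1 xi w')) =
    incsum B t a n w + a n * xi w'.
  rewrite /f row_mxEr /vec1 mxE; congr (_ + _); apply: eq_bigr => i _.
  by rewrite /c !row_mxEl !mxE !inordK// ltnS// ltnW.
under eq_fun do rewrite !fE.
have -> : (fun w => (incsum B t v n w + v n * xi w) * (incsum B t v' n w + v' n * xi w)) =
    (fun w => incsum B t v n.+1 w * incsum B t v' n.+1 w).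
  by apply/funext => w; rewrite /incsum !big_ord_recr.
move=> ->.
have inner w : E (fun w' => f v (row_mx (at_times B (fun i : 'I_n.+1 => t i) w) (vec1 xi w')) *
     f v' (row_mx (at_times B (fun i : 'I_n.+1 => t i) w) (vec1 xi w'))) =
   G (v n * v' n) * (t n.+1 - t n) + incsum B t v n w * incsum B t v' n w.
  rewrite -GfunZ -(G_normal_var_sq _ nxi).
  set x := incsum _ _ _ _ w; set x' := incsum _ _ _ _ w.
  have -> : (fun w' => f v (row_mx (at_times B (fun i : 'I_n.+1 => t i) w) (vec1 xi w')) *
     f v' (row_mx (at_times B (fun i : 'I_n.+1 => t i) w) (vec1 xi w'))) =
     (fun w' => x * x' + (v n * v' n * xi w' ^+ 2 + (x * v' n + x' * v n) * xi w')).
    by apply/funext => w'; rewrite !fE -/x -/x'; ring.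
  have r2 : rv E (fun w => v n * v' n * xi w ^+ 2).
    by apply: rvZ; under eq_fun do rewrite expr2; exact: rvM.
  rewrite expectDc; last by apply: rvD => //; exact: rvZ.
  by rewrite (expectD_zero_mean r2 (zero_meanZ _ zxi)) addrC.
under eq_fun do rewrite inner.
have tge i : (i <= n)%N -> 0 <= t i.
  by move=> i_n; apply/ltW/(incr_upto_gt0 t0 ti').
rewrite expectDc; last by apply: rvM; apply: rv_incsum.
by rewrite ih// big_ord_recr/= addrC.
Qed.

(* Only one direction of independence is available, so [B1] is frozen and the
   zero mean of the increments of [B2] kills the cross terms. *)
Lemma expect_two_incsumM B1 B2 t v v' n u z z' m :
  G_Brownian E sl su B1 -> G_Brownian E sl su B2 ->
  process_independent_of E B2 B1 ->
  0 < t 0%N -> incr_upto t n -> 0 < u 0%N -> incr_upto u m ->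
  E (fun w => (incsum B1 t v n w + incsum B2 u z m w) *
              (incsum B1 t v' n w + incsum B2 u z' m w)) =
  \sum_(i < n) G (v i * v' i) * (t i.+1 - t i) +
  \sum_(i < m) G (z i * z' i) * (u i.+1 - u i).
Proof.
move=> b1 b2 ind t0 ti u0 ui.
have tpos (i : 'I_n.+1) : 0 <= t i by apply/ltW/(incr_upto_gt0 t0 ti); rewrite -ltnS.
have upos (i : 'I_m.+1) : 0 <= u i by apply/ltW/(incr_upto_gt0 u0 ui); rewrite -ltnS.
have {ind} := ind n.+1 m.+1 (fun i => t i) (fun i => u i) tpos upos.
pose c i : 'I_(n.+1 + m.+1) := lshift m.+1 (inord i).
pose d i : 'I_(n.+1 + m.+1) := rshift n.+1 (inord i).
pose f a b (x : 'rV[R]_(n.+1 + m.+1)) := lincoord a n c x + lincoord b m d x.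
have lf a b : lipschitz_fun (f a b) by apply: lipschitzD; exact: lipschitz_lincoord.
move=> /(_ _ (CbLip_lipschitzM (lf v z) (lf v' z'))).
have fE a b w w' : f a b (row_mx (at_times B1 (fun i : 'I_n.+1 => t i) w)
      (at_times B2 (fun i : 'I_m.+1 => u i) w')) =
    incsum B1 t a n w + incsum B2 u b m w'.
  rewrite /f; congr (_ + _); apply: eq_bigr => i _.
    by rewrite /c !row_mxEl !mxE !inordK// ltnS// ltnW.
  by rewrite /d !row_mxEr !mxE !inordK// ltnS// ltnW.
under eq_fun do rewrite !fE.
move=> ->.
have [r1 _ _] := b1; have [r2 _ _] := b2.
have rx a : rv E (incsum B1 t a n).
  by apply: rv_incsum => // i i_n; apply/ltW/(incr_upto_gt0 t0 ti).
have ry a : rv E (incsum B2 u a m).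
  by apply: rv_incsum => // i i_n; apply/ltW/(incr_upto_gt0 u0 ui).
have inner w : E (fun w' => f v z (row_mx (at_times B1 (fun i : 'I_n.+1 => t i) w)
      (at_times B2 (fun i : 'I_m.+1 => u i) w')) *
     f v' z' (row_mx (at_times B1 (fun i : 'I_n.+1 => t i) w)
      (at_times B2 (fun i : 'I_m.+1 => u i) w'))) =
   \sum_(i < m) G (z i * z' i) * (u i.+1 - u i) + incsum B1 t v n w * incsum B1 t v' n w.
  rewrite -(@expect_incsumM B2)//.
  set x := incsum _ _ _ _ w; set x' := incsum _ _ _ _ w.
  under eq_fun do rewrite !fE -/x -/x'.
  have -> : (fun w' => (x + incsum B2 u z m w') * (x' + incsum B2 u z' m w')) =
     (fun w' => x * x' + (incsum B2 u z m w' * incsum B2 u z' m w' +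
        (x' * incsum B2 u z m w' + x * incsum B2 u z' m w'))).
    by apply/funext => w'; ring.
  have rr : rv E (fun w => incsum B2 u z m w * incsum B2 u z' m w) by exact: rvM.
  rewrite expectDc; last by apply: rvD => //; apply: rvD; exact: rvZ.
  rewrite expectD_zero_mean//; first exact: addrC.
  by apply: zero_meanD; apply: zero_meanZ; exact: zero_mean_incsum.
under eq_fun do rewrite inner.
rewrite expectDc; last exact: rvM.
by rewrite expect_incsumM// addrC.
Qed.

End Increments.

(** * Integrals of step functions *)

Section StepRepresentation.
Variable R : realType.
Implicit Types (g : step R) (t u : nat -> R).

Definition step_sum (F : R -> R) g : R :=
  \sum_(p <- g) p.1 * (F p.2.2 - F p.2.1).

Lemma indic_itvoc (a b x : R) : a <= b ->
  \1_(`]a, b]%classic : set R) x = (x <= b)%R%:R - (x <= a)%R%:R :> R.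
Proof.
move=> ab; rewrite indicE mem_setE in_itv/=.
have [xa|xa] := leP x a; last by rewrite subr0.
by rewrite (le_trans xa ab) subrr.
Qed.

Lemma step_fun_sum g (x : R) : is_step g ->
  step_fun g x = step_sum (fun y => (x <= y)%R%:R) g.
Proof.
move=> /allP gs; rewrite /step_fun /step_sum [LHS]big_seq [RHS]big_seq.
by apply: eq_bigr => p /gs p12; rewrite indic_itvoc.
Qed.

(** The signed coefficient is correct for [i] and [j] in either order. Both orders occur: on the
    reflected grid [- u] a left endpoint has the larger index. *)
Lemma telescope_coef t (F : R -> R) n i j : (i <= n)%N -> (j <= n)%N ->
  F (t j) - F (t i) =
  \sum_(k < n) ((k < j)%N%:R - (k < i)%N%:R) * (F (t k.+1) - F (t k)).
Proof.
have tel l : (l <= n)%N ->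
    F (t l) - F (t 0%N) = \sum_(k < n) (k < l)%N%:R * (F (t k.+1) - F (t k)).
  move=> ln; rewrite -(telescope_sumr (F \o t) (leq0n l)) big_mkord.
  rewrite (big_ord_widen n (fun k => F (t k.+1) - F (t k)) ln) big_mkcond/=.
  by apply: eq_bigr => k _; case: ifP; rewrite ?mul1r ?mul0r.
move=> i_n j_n; under eq_bigr do rewrite mulrBl.
by rewrite sumrB -!tel//; ring.
Qed.

(** Both endpoints of an interval lie on the same side of 0. The negative side is stored as the
    reflection of a positive grid because the two-sided process there is [B2] at the reflected
    time. *)
Definition step_on t n u m g := forall p, p \in g ->
  (exists i j, [/\ (i <= n)%N, (j <= n)%N, p.2.1 = t i & p.2.2 = t j]) \/
  (exists i j, [/\ (i <= m)%N, (j <= m)%N, p.2.1 = - u i & p.2.2 = - u j]).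

(* The coefficients do not depend on [F]: taking for [F] the paths of [B] gives
   the step integral, and taking [y |-> (x <= y)%:R] gives the step function. *)
Lemma step_sum_on t n u m g : step_on t n u m g ->
  exists v z : nat -> R, forall F, step_sum F g =
    \sum_(i < n) v i * (F (t i.+1) - F (t i)) +
    \sum_(i < m) z i * (F (- u i.+1) - F (- u i)).
Proof.
elim: g => [|p g ih] gon.
  exists (fun=> 0), (fun=> 0) => F; rewrite /step_sum big_nil.
  by rewrite !big1 ?addr0// => i _; rewrite mul0r.
have [|v [z vz]] := ih; first by move=> q qg; apply: gon; rewrite inE qg orbT.
have [|[i [j]] [i_n j_n pi pj]|[i [j]] [i_n j_n pi pj]] := gon p; first by rewrite inE eqxx.
  exists (fun k => p.1 * ((k < j)%N%:R - (k < i)%N%:R) + v k), z => F.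
  rewrite /step_sum big_cons -/(step_sum F g) vz pi pj.
  rewrite (telescope_coef t F i_n j_n) mulr_sumr addrA -big_split/=; congr (_ + _).
  by apply: eq_bigr => k _; rewrite [RHS]mulrDl mulrA.
exists v, (fun k => p.1 * ((k < j)%N%:R - (k < i)%N%:R) + z k) => F.
rewrite /step_sum big_cons -/(step_sum F g) vz pi pj.
have /= -> := telescope_coef (fun k => - u k) F i_n j_n.
rewrite mulr_sumr addrCA -big_split/=.
by congr (_ + _); apply: eq_bigr => k _; rewrite [RHS]mulrDl mulrA.
Qed.

Lemma exists_grid (s : seq R) : exists t n, [/\ 0 < t 0%N, incr_upto t n &
  forall x, x \in s -> 0 < x -> exists2 i, (i <= n)%N & x = t i].
Proof.
(* The point 1 is added so that the grid is nonempty and starts at a positive time even if [s] has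
   no positive entry. *)
pose s' := sort <=%O (undup (1 :: [seq x <- s | 0 < x])).
have s'E x : (x \in s') = (x == 1) || (x \in s) && (0 < x).
  by rewrite mem_sort mem_undup inE mem_filter andbC.
have s'0 : (0 < size s')%N.
  have : 1 \in s' by rewrite s'E eqxx.
  by clear; case: s'.
have ss : sorted <%O s' by rewrite sort_lt_sorted undup_uniq.
exists (nth 0 s'), (size s').-1; split.
- have : nth 0 s' 0 \in s' by exact: mem_nth.
  by rewrite s'E => /orP[/eqP->|/andP[]].
- move=> i j /andP[ij jn]; rewrite -ltnS prednK// in jn.
  by rewrite (lt_sorted_ltn_nth 0)// inE// (ltn_trans ij).
move=> x xs x0; have xs' : x \in s' by rewrite s'E xs x0 orbT.
exists (index x s'); last by rewrite nth_index.
by rewrite -ltnS prednK// index_mem.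
Qed.

(* [G_Brownian] constrains only increments starting at a positive time, so it
   does not exclude a jump at 0+; step functions are therefore kept away from
   0, where their integrals are determined by the axioms. *)
Definition off_zero g := forall p, p \in g ->
  0 < p.2.1 /\ 0 < p.2.2 \/ p.2.1 < 0 /\ p.2.2 < 0.

(** One grid must serve both step functions, because the expectation of a product of sums pairs
    their coefficients interval by interval. *)
Lemma exists_common_grid f g : off_zero f -> off_zero g ->
  exists t n u m, [/\ 0 < t 0%N /\ incr_upto t n, 0 < u 0%N /\ incr_upto u m,
    step_on t n u m f & step_on t n u m g].
Proof.
move=> f0 g0.
pose pts := flatten [seq [:: p.2.1; p.2.2] | p <- f ++ g].
have [t [n [t0 ti ht]]] := exists_grid pts.
have [u [m [u0 ui hu]]] := exists_grid [seq - x | x <- pts].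
have pts1 p : p \in f ++ g -> p.2.1 \in pts /\ p.2.2 \in pts.
  by move=> pf; split; apply/flatten_mapP; exists p; rewrite ?inE ?eqxx ?orbT.
have on p : p \in f ++ g -> 0 < p.2.1 /\ 0 < p.2.2 \/ p.2.1 < 0 /\ p.2.2 < 0 ->
  (exists i j, [/\ (i <= n)%N, (j <= n)%N, p.2.1 = t i & p.2.2 = t j]) \/
  (exists i j, [/\ (i <= m)%N, (j <= m)%N, p.2.1 = - u i & p.2.2 = - u j]).
  move=> /pts1[p1 p2] [[a0 b0]|[a0 b0]]; [left|right].
    have [i i_n ei] := ht _ p1 a0; have [j j_n ej] := ht _ p2 b0.
    by exists i, j.
  have [||i i_n ei] := hu (- p.2.1); [by rewrite map_f|by rewrite oppr_gt0|].
  have [||j j_n ej] := hu (- p.2.2); [by rewrite map_f|by rewrite oppr_gt0|].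
  by exists i, j; rewrite -ei -ej !opprK.
exists t, n, u, m; split=> // p pf; apply: on; rewrite ?mem_cat ?pf ?orbT//.
- exact: f0.
- exact: g0.
Qed.

End StepRepresentation.

Section StepIntegral.
Variable R : realType.
Implicit Types (g : step R) (t u : nat -> R).
Local Notation mu := (@lebesgue_measure R).

(** At most one [c i] is nonzero, so each sum has at most one term and the nonlinear [Gfun] acts on
    a single product. The sign of that [c i] appears twice and cancels. *)
Lemma Gfun_orthogonal (vl vu : R) n (v w c : 'I_n -> R) :
  (forall i, [\/ c i = 0, c i = 1 | c i = -1]) ->
  (forall i j, i != j -> c i * c j = 0) ->
  Gfun vl vu ((\sum_(i < n) v i * c i) * (\sum_(i < n) w i * c i)) =
  \sum_(i < n) Gfun vl vu (v i * w i) * c i ^+ 2.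
Proof.
move=> c01 co; have [i ci|c0] := pickP (fun i => c i != 0).
  have cj j : j != i -> c j = 0.
    by move=> /co/eqP; rewrite mulf_eq0 (negbTE ci) orbF => /eqP.
  have only_i (a e : 'I_n -> R) : (forall j, j != i -> e j = 0) ->
      \sum_(j < n) a j * e j = a i * e i.
    by move=> e0; rewrite (bigD1 i)//= big1 ?addr0// => j /e0->; rewrite mulr0.
  rewrite (only_i v c)// (only_i w c)//.
  rewrite (only_i (fun j => Gfun vl vu (v j * w j)) (fun j => c j ^+ 2)); last first.
    by move=> j /cj->; rewrite expr0n.
  have [c1|->|->] := c01 i; first by rewrite c1 eqxx in ci.
    by rewrite expr1n !mulr1.
  by rewrite sqrrN expr1n !mulrN1 mulrNN mulr1.
have {}c0 i : c i = 0 by apply/eqP/negPn; rewrite c0.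
rewrite !big1 ?mul0r ?Gfun0// => i _; by rewrite c0 ?expr0n ?mulr0.
Qed.

(** An indicator up to sign: on an increasing grid it is that of ]t i, t (i+1)], on a reflected grid
    it is minus that of the reversed interval. *)
Definition jump t i (x : R) : R := (x <= t i.+1)%R%:R - (x <= t i)%R%:R.

Lemma jump01 t i x : [\/ jump t i x = 0, jump t i x = 1 | jump t i x = -1].
Proof.
rewrite /jump; case: (x <= t i); case: (x <= t i.+1); rewrite ?subrr ?subr0 ?sub0r.
- by constructor 1. - by constructor 3. - by constructor 2. - by constructor 1.
Qed.

Lemma jump_orthogonal t n x : incr_upto t n ->
  forall i j : 'I_n, i != j -> jump t i x * jump t j x = 0.
Proof.
move=> ti.
suff h (i j : 'I_n) : (i < j)%N -> jump t i x * jump t j x = 0.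
  move=> i j; rewrite -val_eqE neq_ltn => /orP[/h//|/h]; by rewrite mulrC.
move=> ij; have le1 : t i.+1 <= t j by apply: (incr_upto_le ti); rewrite ij ltnW.
have le0 : t i <= t i.+1 by apply: (incr_upto_le ti); rewrite leqnSn ltn_ord.
have le2 : t j <= t j.+1 by apply: (incr_upto_le ti); rewrite leqnSn ltn_ord.
rewrite /jump; have [xj|xj] := leP x (t j).
  by rewrite (le_trans xj le2) subrr mulr0.
rewrite [x <= t i.+1]leNgt (le_lt_trans le1 xj) [x <= t i]leNgt.
by rewrite (le_lt_trans (le_trans le0 le1) xj) subrr mul0r.
Qed.

Lemma jumpN_orthogonal t n x : incr_upto t n ->
  forall i j : 'I_n, i != j -> jump (fun k => - t k) i x * jump (fun k => - t k) j x = 0.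
Proof.
move=> ti.
suff h (i j : 'I_n) : (i < j)%N ->
    jump (fun k => - t k) i x * jump (fun k => - t k) j x = 0.
  move=> i j; rewrite -val_eqE neq_ltn => /orP[/h//|/h]; by rewrite mulrC.
move=> ij; have le1 : t i.+1 <= t j by apply: (incr_upto_le ti); rewrite ij ltnW.
have le0 : t i <= t i.+1 by apply: (incr_upto_le ti); rewrite leqnSn ltn_ord.
have le2 : t j <= t j.+1 by apply: (incr_upto_le ti); rewrite leqnSn ltn_ord.
rewrite /jump; have [xj|xj] := leP x (- t j).
  have x1 : x <= - t i.+1 by apply: le_trans xj _; rewrite lerN2.
  by rewrite x1 (le_trans x1)// ?lerN2// subrr mul0r.
by rewrite [x <= - t j.+1]leNgt (le_lt_trans _ xj) ?lerN2// subrr mulr0.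
Qed.

Lemma jump_sq t i (x : R) : t i <= t i.+1 ->
  jump t i x ^+ 2 = \1_(`]t i, t i.+1]%classic : set R) x.
Proof.
move=> le1; rewrite indic_itvoc// -/(jump t i x) /jump.
have [xj|xj] := leP x (t i); first by rewrite (le_trans xj le1) subrr expr2 mulr0.
by rewrite subr0; case: (x <= _); rewrite ?expr1n ?expr2 ?mulr0.
Qed.

Lemma jumpN_sq t i (x : R) : t i <= t i.+1 ->
  jump (fun k => - t k) i x ^+ 2 = \1_(`]- t i.+1, - t i]%classic : set R) x.
Proof.
move=> le1; rewrite indic_itvoc ?lerN2// /jump -sqrrN opprB.
have [xj|xj] := leP x (- t i.+1); last first.
  by rewrite subr0; case: (x <= _); rewrite ?expr1n ?expr2 ?mulr0.
by rewrite (le_trans xj) ?lerN2// subrr expr2 mulr0.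
Qed.

(** The two grids lie on opposite sides of 0, so at each [x] one of the two families of jumps
    vanishes and the other one is orthogonal. *)
Lemma Gfun_jumps (vl vu : R) t n u m (v v' z z' : nat -> R) x :
  0 < t 0%N -> incr_upto t n -> 0 < u 0%N -> incr_upto u m ->
  Gfun vl vu
   ((\sum_(i < n) v i * jump t i x + \sum_(i < m) z i * jump (fun k => - u k) i x) *
    (\sum_(i < n) v' i * jump t i x + \sum_(i < m) z' i * jump (fun k => - u k) i x)) =
  \sum_(i < n) Gfun vl vu (v i * v' i) * \1_(`]t i, t i.+1]%classic : set R) x +
  \sum_(i < m) Gfun vl vu (z i * z' i) * \1_(`]- u i.+1, - u i]%classic : set R) x.
Proof.
move=> t0 ti u0 ui.
have leS (w : nat -> R) k (hw : incr_upto w k) (i : 'I_k) : w i <= w i.+1.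
  by apply: (incr_upto_le hw); rewrite leqnSn ltn_ord.
rewrite [X in _ = X + _](eq_bigr (fun i : 'I_n =>
    Gfun vl vu (v i * v' i) * jump t i x ^+ 2)); last first.
  by move=> i _; rewrite jump_sq// (leS _ _ ti).
rewrite [X in _ = _ + X](eq_bigr (fun i : 'I_m =>
    Gfun vl vu (z i * z' i) * jump (fun k => - u k) i x ^+ 2)); last first.
  by move=> i _; rewrite jumpN_sq// (leS _ _ ui).
have sum0 k (a : nat -> R) (c : 'I_k -> R) (c0 : forall i, c i = 0) :
    \sum_(i < k) a i * c i = 0 /\ forall b : nat -> R, \sum_(i < k) b i * c i ^+ 2 = 0.
  by split=> [|b]; rewrite big1// => i _; rewrite c0 ?expr0n ?mulr0.
have [x0|x0] := leP x 0.
  have j0 (i : 'I_n) : jump t i x = 0.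
    have h k : (k <= n)%N -> x <= t k.
      by move=> kn; apply/(le_trans x0)/ltW/(incr_upto_gt0 t0 ti).
    by rewrite /jump !h ?subrr// ltnW.
  have [-> _] := sum0 n v _ j0.
  have [-> /(_ (fun i => Gfun vl vu (v i * v' i)))->] := sum0 n v' _ j0.
  rewrite !add0r; apply: Gfun_orthogonal => [i|]; first exact: jump01.
  exact: jumpN_orthogonal.
have j0 (i : 'I_m) : jump (fun k => - u k) i x = 0.
  have h k : (k <= m)%N -> (x <= - u k) = false.
    move=> km; apply/negbTE; rewrite -ltNge (lt_trans _ x0)// oppr_lt0.
    exact: (incr_upto_gt0 u0 ui).
  by rewrite /jump !h ?subrr// ltnW.
have [-> _] := sum0 m z _ j0.
have [-> /(_ (fun i => Gfun vl vu (z i * z' i)))->] := sum0 m z' _ j0.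
rewrite !addr0; apply: Gfun_orthogonal => [i|]; first exact: jump01.
exact: jump_orthogonal.
Qed.

Definition rintegrable (f : R -> R) := mu.-integrable setT (EFin \o f).

Lemma rintegrableD (f g : R -> R) : rintegrable f -> rintegrable g ->
  rintegrable (fun x => f x + g x).
Proof. by move=> fi gi; exact: (integrableD measurableT fi gi). Qed.

Lemma rintegrableZ (a : R) (f : R -> R) : rintegrable f -> rintegrable (fun x => a * f x).
Proof. by move=> fi; exact: (integrableZl measurableT a fi). Qed.

Lemma rintegrable0 : rintegrable (fun=> 0).
Proof. exact: integrable0. Qed.

Lemma rintegrable_indic_itvoc (a b : R) :
  rintegrable (\1_(`]a, b]%classic : set R) : R -> R).
Proof. exact: integrable_indic_itv. Qed.

Lemma Rintegral_indic_itvoc (a b : R) : a <= b ->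
  \int[mu]_x (\1_(`]a, b]%classic : set R) x) = b - a.
Proof.
move=> ab; rewrite /Rintegral integral_indic//= setIT lebesgue_measure_itv/=.
rewrite lte_fin; case: ltP => //= ba.
by apply/esym/eqP; rewrite subr_eq0 eq_le ab ba.
Qed.

Lemma rintegrable_sum_indic n (c a b : nat -> R) :
  rintegrable (fun x => \sum_(i < n) c i * \1_(`]a i, b i]%classic : set R) x).
Proof.
elim: n => [|n ih].
  by under eq_fun do rewrite big_ord0; exact: rintegrable0.
under eq_fun do rewrite big_ord_recr/=.
by apply: rintegrableD => //; apply/rintegrableZ/rintegrable_indic_itvoc.
Qed.

Lemma Rintegral_sum_indic n (c a b : nat -> R) :
  (forall i, (i < n)%N -> a i <= b i) ->
  \int[mu]_x (\sum_(i < n) c i * \1_(`]a i, b i]%classic : set R) x) =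
  \sum_(i < n) c i * (b i - a i).
Proof.
elim: n => [|n ih] ab.
  under eq_Rintegral do rewrite big_ord0.
  by rewrite big_ord0 Rintegral_cst// mul0r.
under eq_Rintegral do rewrite big_ord_recr/=.
have h := rintegrable_indic_itvoc (a n) (b n).
rewrite RintegralD//; [|exact: rintegrable_sum_indic|exact: rintegrableZ].
rewrite RintegralZl// Rintegral_indic_itvoc ?ab// ih ?big_ord_recr//.
by move=> i i_n; apply: ab; exact: ltnW.
Qed.

End StepIntegral.

Lemma expect_step_integralM (R : realType) (Omega : Type)
    (E : sublinear_expectation R Omega) (sl su : R) (B : R -> Omega -> R)
    (f g : step R) : two_sided_G_Brownian E sl su B ->
  is_step f -> is_step g -> off_zero f -> off_zero g ->
  E (fun w => step_integral B f w * step_integral B g w) =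
  \int[@lebesgue_measure R]_x
    Gfun (sl ^+ 2) (su ^+ 2) (step_fun f x * step_fun g x).
Proof.
move=> [B1 [B2 [b1 b2 ind ->]]] sf sg f0 g0.
have [t [n [u [m [[t0 ti] [u0 ui] fon gon]]]]] := exists_common_grid f0 g0.
have [v [z vz]] := step_sum_on fon; have [v' [z' vz']] := step_sum_on gon.
have tle i : (i < n)%N -> t i <= t i.+1.
  by move=> i_n; apply: (incr_upto_le ti); rewrite leqnSn.
have ule i : (i < m)%N -> - u i.+1 <= - u i.
  by move=> i_m; rewrite lerN2; apply: (incr_upto_le ui); rewrite leqnSn.
have SE h (a c : nat -> R) : (forall F, step_sum F h =
    \sum_(i < n) a i * (F (t i.+1) - F (t i)) +
    \sum_(i < m) c i * (F (- u i.+1) - F (- u i))) ->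
    step_integral (two_sided B1 B2) h =
    fun w => incsum B1 t a n w + incsum B2 u c m w.
  move=> hE; apply/funext => w.
  rewrite /step_integral -/(step_sum (fun y => two_sided B1 B2 y w) h) hE.
  congr (_ + _); apply: eq_bigr => i _; rewrite /two_sided.
    by rewrite !ltW// (incr_upto_gt0 t0 ti)// ltnW.
  have h0 k : (k <= m)%N -> (0 <= - u k) = false.
    by move=> km; rewrite oppr_ge0 leNgt (incr_upto_gt0 u0 ui).
  by rewrite !h0 ?opprK// ltnW.
rewrite (SE _ _ _ vz) (SE _ _ _ vz').
under eq_Rintegral => x _.
  rewrite !step_fun_sum// vz vz' (Gfun_jumps _ _ _ _ _ _ x t0 ti u0 ui).
  over.
rewrite RintegralD//; last 2 first.
- exact: (rintegrable_sum_indic n (fun i => Gfun _ _ (v i * v' i)) t (fun i => t i.+1)).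
- exact: (rintegrable_sum_indic m (fun i => Gfun _ _ (z i * z' i))
    (fun i => - u i.+1) (fun i => - u i)).
rewrite (@Rintegral_sum_indic _ n (fun i => Gfun _ _ (v i * v' i)) t (fun i => t i.+1))//.
rewrite (@Rintegral_sum_indic _ m (fun i => Gfun _ _ (z i * z' i))
  (fun i => - u i.+1) (fun i => - u i))//.
have -> : \sum_(i < m) Gfun (sl ^+ 2) (su ^+ 2) (z i * z' i) * (- u i - - u i.+1) =
  \sum_(i < m) Gfun (sl ^+ 2) (su ^+ 2) (z i * z' i) * (u i.+1 - u i).
  by apply: eq_bigr => i _; rewrite opprK addrC.
(* If [B1] is the half independent of [B2], the roles of the halves and of their grids are
   exchanged. *)
case: ind => ind; first exact: expect_two_incsumM.
rewrite addrC -(expect_two_incsumM _ _ _ _ b2 b1 ind u0 ui t0 ti).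
by congr (E _); apply/funext => w; rewrite [X in X * _]addrC [X in _ * X]addrC.
Qed.

(** * Scalar inequalities for passing to limits *)

Section RealLemmas.
Variable R : realType.

Lemma normM_young (l a b : R) : 0 < l -> `|a * b| <= l * a ^+ 2 + l^-1 * b ^+ 2.
Proof.
move=> l0; rewrite normrM -(real_normK (num_real a)) -(real_normK (num_real b)).
move: `|a| `|b| (normr_ge0 a) (normr_ge0 b) => {a b} x y x0 y0.
have -> : l * x ^+ 2 + l^-1 * y ^+ 2 = l * (x - l^-1 * y) ^+ 2 + 2 * x * y.
  by field; rewrite gt_eqF.
have := mulr_ge0 (ltW l0) (sqr_ge0 (x - l^-1 * y)); have := mulr_ge0 x0 y0; lra.
Qed.

(** Takes the place of the Cauchy-Schwarz inequality. Being pointwise, it can be used under [E] and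
    under the Lebesgue integral alike; the free weight [l] makes the part without errors small. *)
Lemma norm_prod_diff (l x y a b : R) : 0 < l ->
  `|x * y - a * b| <= l * (a ^+ 2 + b ^+ 2) + (l^-1 + 1) * ((x - a) ^+ 2 + (y - b) ^+ 2).
Proof.
move=> l0; have -> : x * y - a * b = (x - a) * (y - b) + (a * (y - b) + b * (x - a)) by ring.
have h1 := normM_young (x - a) (y - b) ltr01; rewrite invr1 !mul1r in h1.
have h2 := normM_young a (y - b) l0.
have h3 := normM_young b (x - a) l0.
apply: le_trans (ler_normD _ _) _.
have h4 := ler_normD (a * (y - b)) (b * (x - a)).
move: h1 h2 h3 h4; move: (x - a) (y - b) (l^-1) => p q s h1 h2 h3 h4.
lra.
Qed.

Lemma cvg0_young (u d : nat -> R) (K : R) : 0 <= K ->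
  (forall l k, 0 < l -> `|u k| <= l * K + (l^-1 + 1) * d k) ->
  d @ \oo --> (0 : R) -> u @ \oo --> (0 : R).
Proof.
move=> K0 ud /cvgrPdist_le d0; apply/cvgrPdist_le => e e0.
(* The weight is fixed before [k], so that [l * K] takes at most half of [e]; [K + 1] avoids a
   division by 0. *)
pose l := e / 2 / (K + 1).
have K1 : 0 < K + 1 by rewrite ltr_wpDl.
have l0 : 0 < l by rewrite !divr_gt0.
have lK : l * K <= e / 2.
  have -> : e / 2 = l * (K + 1) by rewrite /l divfK// gt_eqF.
  by rewrite ler_pM2l// lerDl.
have C0 : 0 < l^-1 + 1 by rewrite addr_gt0// invr_gt0.
near=> k; rewrite sub0r normrN; apply: le_trans (ud l k l0) _.
have : `|0 - d k| <= e / 2 / (l^-1 + 1).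
  by near: k; apply: d0; rewrite !divr_gt0.
rewrite sub0r normrN => dk.
have : (l^-1 + 1) * d k <= e / 2.
  have -> : e / 2 = (l^-1 + 1) * (e / 2 / (l^-1 + 1)) by rewrite [RHS]mulrC divfK// gt_eqF.
  by rewrite ler_pM2l//; apply: le_trans dk; exact: ler_norm.
have : e = e / 2 + e / 2 by field.
lra.
Unshelve. all: by end_near. Qed.

(** [Gfun] is piecewise linear with slopes [vl] and [vu], both between 0 and [vu]. *)
Lemma Gfun_lipschitz (vl vu x y : R) : 0 <= vl <= vu ->
  `|Gfun vl vu x - Gfun vl vu y| <= vu * `|x - y|.
Proof.
move=> /andP[vl0 vlu]; wlog yx : x y / y <= x.
  move=> h; have [/h//|/ltW/h] := leP y x.
  by rewrite distrC [`|y - x|]distrC.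
have vu0 : 0 <= vu by exact: le_trans vlu.
have xy0 : 0 <= x - y by rewrite subr_ge0.
suff : 0 <= Gfun vl vu x - Gfun vl vu y <= vu * (x - y).
  by move=> /andP[g0 g1]; rewrite !ger0_norm.
rewrite !GfunE; case: (leP 0 x) => x0; case: (leP 0 y) => y0.
- by rewrite -mulrBr mulr_ge0//=.
- have := mulr_ge0 vu0 x0; have := mulr_ge0 vl0 (ltW (_ : 0 < - y)).
  rewrite oppr_gt0 => /(_ y0) h1 h2.
  have : (vu - vl) * (- y) >= 0 by apply: mulr_ge0; lra.
  by move=> h3; apply/andP; split; lra.
(* Here [x < 0 <= y], against [y <= x]. *)
- by lra.
have := mulr_ge0 vl0 xy0.
have : (vu - vl) * (x - y) >= 0 by apply: mulr_ge0; lra.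
by move=> h1 h2; apply/andP; split; lra.
Qed.

Lemma Gfun_norm_le (vl vu x : R) : 0 <= vl <= vu -> `|Gfun vl vu x| <= vu * `|x|.
Proof. by move=> /Gfun_lipschitz - /(_ x 0); rewrite Gfun0 !subr0. Qed.

End RealLemmas.

(** * Square-integrable functions and step approximations *)

Section SquareIntegrable.
Variable R : realType.
Local Notation mu := (@lebesgue_measure R).
Implicit Types f h : R -> R.

Lemma rintegrable_measurable f : rintegrable f -> measurable_fun setT f.
Proof. by move=> /(measurable_int mu)/measurable_EFinP. Qed.

Lemma rintegrable_le f h : measurable_fun setT f -> rintegrable h ->
  (forall x, `|f x| <= h x) -> rintegrable f.
Proof.
move=> mf hi fh; apply: (le_integrable measurableT _ _ hi); first exact/measurable_EFinP.
by move=> x _ /=; rewrite lee_fin (le_trans (fh x))// ler_norm.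
Qed.

Lemma measurable_Gfun (vl vu : R) f :
  measurable_fun setT f -> measurable_fun setT (fun x => Gfun vl vu (f x)).
Proof.
move=> mf; rewrite /Gfun; apply: measurable_funD; apply: measurable_funM => //.
  exact: measurable_maxr.
exact: measurable_minr.
Qed.

Lemma rintegrable_Gfun (vl vu : R) f : 0 <= vl <= vu ->
  rintegrable f -> rintegrable (fun x => Gfun vl vu (f x)).
Proof.
move=> v fi; apply: (@rintegrable_le _ (fun x => vu * `|f x|)).
- by apply: measurable_Gfun; exact: rintegrable_measurable.
- by apply: rintegrableZ; exact: integrable_norm.
- by move=> x; exact: Gfun_norm_le.
Qed.

Definition sq_integrable f :=
  measurable_fun setT f /\ rintegrable (fun x => f x ^+ 2).

Lemma sq_integrableM f h : sq_integrable f -> sq_integrable h ->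
  rintegrable (fun x => f x * h x).
Proof.
move=> [mf f2] [mh h2]; apply: rintegrable_le (rintegrableD f2 h2) _.
  exact: measurable_funM.
by move=> x; have := normM_young (f x) (h x) ltr01; rewrite invr1 !mul1r.
Qed.

Lemma sq_integrableZ a f : sq_integrable f -> sq_integrable (fun x => a * f x).
Proof.
move=> [mf f2]; split; first exact: measurable_funM.
by under eq_fun do rewrite exprMn; exact: rintegrableZ.
Qed.

Lemma sqrD_le (a b : R) : (a + b) ^+ 2 <= 2 * a ^+ 2 + 2 * b ^+ 2.
Proof.
have -> : 2 * a ^+ 2 + 2 * b ^+ 2 = (a + b) ^+ 2 + (a - b) ^+ 2 by ring.
by rewrite lerDl sqr_ge0.
Qed.

Lemma sq_integrableD f h : sq_integrable f -> sq_integrable h ->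
  sq_integrable (fun x => f x + h x).
Proof.
move=> [mf f2] [mh h2]; have mfh : measurable_fun setT (fun x => f x + h x).
  exact: measurable_funD.
split=> //; apply: rintegrable_le (rintegrableD (rintegrableZ 2 f2) (rintegrableZ 2 h2)) _.
  exact: measurable_funX.
by move=> x; rewrite ger0_norm ?sqr_ge0// sqrD_le.
Qed.

Lemma sq_integrableB f h : sq_integrable f -> sq_integrable h ->
  sq_integrable (fun x => f x - h x).
Proof.
move=> fi /(sq_integrableZ (-1)) hi; have := sq_integrableD fi hi.
by congr sq_integrable; apply/funext => x; rewrite mulN1r.
Qed.

Lemma rintegrable_step_fun (g : step R) : rintegrable (step_fun g).
Proof.
rewrite /step_fun; elim: g => [|p g ih].
  by under eq_fun do rewrite big_nil; exact: rintegrable0.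
under eq_fun do rewrite big_cons; apply: rintegrableD => //.
exact/rintegrableZ/rintegrable_indic_itvoc.
Qed.

Definition step_bound (g : step R) : R := \sum_(p <- g) `|p.1|.

Lemma step_bound_ge0 g : 0 <= step_bound g.
Proof. exact: sumr_ge0. Qed.

Lemma step_fun_le (g : step R) x : `|step_fun g x| <= step_bound g.
Proof.
apply: le_trans (ler_norm_sum _ _ _) _; apply: ler_sum => p _.
by rewrite normrM indicE; case: (_ \in _); rewrite ?normr1 ?mulr1 ?normr0 ?mulr0.
Qed.

Lemma sq_integrable_step_fun (g : step R) : sq_integrable (step_fun g).
Proof.
have ig := rintegrable_step_fun g; have mg := rintegrable_measurable ig.
split=> //; apply: (@rintegrable_le _ (fun x => step_bound g * `|step_fun g x|)).
- exact: measurable_funX.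
- by apply: rintegrableZ; exact: integrable_norm.
- by move=> x; rewrite normrX expr2 ler_wpM2r// step_fun_le.
Qed.

(** [Rintegral] is 0 when the integral is infinite, so this is the squared L^2 distance only between
    square-integrable functions; [EFin_sq_dist] makes the link. *)
Definition sq_dist f h : R := \int[mu]_x ((f x - h x) ^+ 2).

Lemma sq_dist_ge0 f h : 0 <= sq_dist f h.
Proof. by apply: Rintegral_ge0 => x _; exact: sqr_ge0. Qed.

Lemma EFin_sq_dist f h : sq_integrable f -> sq_integrable h ->
  (\int[mu]_x ((f x - h x) ^+ 2)%:E)%E = (sq_dist f h)%:E.
Proof.
move=> fi hi; have [_ fh2] := sq_integrableB fi hi.
by rewrite /sq_dist /Rintegral fineK//; exact: integrable_fin_num.
Qed.

Lemma sq_dist_triangle f h k : sq_integrable f -> sq_integrable h -> sq_integrable k ->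
  sq_dist f k <= 2 * sq_dist f h + 2 * sq_dist h k.
Proof.
move=> fi hi ki.
have [_ i1] := sq_integrableB fi hi; have [_ i2] := sq_integrableB hi ki.
have [_ i3] := sq_integrableB fi ki.
rewrite /sq_dist -!RintegralZl// -RintegralD//; try exact: rintegrableZ.
apply: le_Rintegral => //; first by apply: rintegrableD; exact: rintegrableZ.
by move=> x _; have := sqrD_le (f x - h x) (h x - k x); rewrite addrA subrK.
Qed.

(** Convergence to 0 makes the integral finite at some index, so [f] is a step function minus a
    square-integrable function. The kernel is known to be square-integrable in this way, with no
    estimate at its singularities. *)
Lemma step_approx_sq_integrable f g : measurable_fun setT f ->
  step_approx f g -> sq_integrable f.
Proof.
move=> mf [_ /fine_cvgP[[N _ /(_ N (leqnn N)) fN] _]].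
have [mg g2] := sq_integrable_step_fun (g N).
have gf : sq_integrable (fun x => step_fun (g N) x - f x).
  have mgf : measurable_fun setT (fun x => (step_fun (g N) x - f x) ^+ 2).
    by apply: measurable_funX; exact: measurable_funB.
  split; first exact: measurable_funB.
  apply/integrableP; split; first exact/measurable_EFinP.
  under eq_integral do rewrite gee0_abs ?lee_fin ?sqr_ge0//.
  by rewrite -ge0_fin_numE//; apply: integral_ge0 => x _; rewrite lee_fin sqr_ge0.
have := sq_integrableB (conj mg g2) gf.
by congr sq_integrable; apply/funext => x; rewrite subKr.
Qed.

Lemma step_approxP f g : sq_integrable f ->
  step_approx f g <-> (forall k, is_step (g k)) /\
    (fun k => sq_dist (step_fun (g k)) f) @ \oo --> (0 : R).
Proof.
move=> fi; rewrite /step_approx.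
have -> : (fun k => \int[mu]_x ((step_fun (g k) x - f x) ^+ 2)%:E)%E =
    EFin \o (fun k => sq_dist (step_fun (g k)) f).
  by apply/funext => k /=; rewrite EFin_sq_dist//; exact: sq_integrable_step_fun.
split=> -[gs h]; split=> //; first by have /fine_cvgP[] := h.
by apply/fine_cvgP; split=> //; exact: nearW.
Qed.

(** Sets the function to 0 on ]-e, e]: each interval is split into its parts right of [e] and left
    of [- e]. A missing part becomes an empty interval with equal endpoints. *)
Definition step_cut (e : R) (g : step R) : step R :=
  [seq (p.1, (Num.max p.2.1 e, Num.max p.2.2 e)) | p <- g] ++
  [seq (p.1, (Num.min p.2.1 (- e), Num.min p.2.2 (- e))) | p <- g].

Lemma is_step_cut e g : is_step g -> is_step (step_cut e g).
Proof.
move=> /allP gs; rewrite /is_step all_cat !all_map; apply/andP; split; apply/allP => p /gs /= h.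
  by rewrite ge_max !le_max h lexx orbT.
by rewrite le_min !ge_min h lexx orbT.
Qed.

Lemma off_zero_cut e g : 0 < e -> off_zero (step_cut e g).
Proof.
move=> e0 p; rewrite mem_cat => /orP[] /mapP[q _ ->] /=; [left|right].
  by rewrite !lt_max e0 !orbT.
by rewrite !gt_min oppr_lt0 e0 !orbT.
Qed.

Lemma step_fun_cut e g x : 0 < e -> is_step g ->
  step_fun (step_cut e g) x = step_fun g x - \1_(`]- e, e]%classic : set R) x * step_fun g x.
Proof.
move=> e0 gs; rewrite step_fun_sum ?is_step_cut// step_fun_sum//.
rewrite /step_sum big_cat/= !big_map/= -big_split/= mulr_sumr -sumrB.
rewrite indic_itvoc; last by rewrite ge0_cp ?ltW.
apply: eq_bigr => p _; rewrite !le_max !le_min.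
(* This excludes the contradictory combinations from the case analysis on booleans that follows. *)
have : (x <= - e) ==> (x <= e) by apply/implyP => /le_trans; apply; rewrite ge0_cp// ltW.
case: (x <= - e); case: (x <= e); case: (x <= p.2.1); case: (x <= p.2.2) => //= _; ring.
Qed.

Lemma sq_dist_cut e g : 0 < e -> is_step g ->
  sq_dist (step_fun (step_cut e g)) (step_fun g) <= step_bound g ^+ 2 * (2 * e).
Proof.
move=> e0 gs; have eNe : - e <= e by rewrite ge0_cp ?ltW.
have -> : 2 * e = e - - e by ring.
have [_ i1] := sq_integrableB (sq_integrable_step_fun (step_cut e g)) (sq_integrable_step_fun g).
rewrite -(Rintegral_indic_itvoc eNe) -RintegralZl//; last exact: rintegrable_indic_itvoc.
apply: le_Rintegral => //; first exact/rintegrableZ/rintegrable_indic_itvoc.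
move=> x _; rewrite step_fun_cut// addrAC subrr sub0r sqrrN exprMn.
rewrite indicE; case: (_ \in _); rewrite ?expr0n ?mul0r ?mulr0// expr1n mul1r mulr1.
by rewrite -[leLHS]real_normK ?num_real// lerXn2r ?nnegrE ?step_bound_ge0 ?step_fun_le.
Qed.

(** Chosen so that cutting the [k]-th step function costs at most [2 / (k + 1)] in squared distance,
    however large its coefficients are. *)
Definition cut_width (g : step R) (k : nat) : R := (step_bound g ^+ 2 + 1)^-1 * k.+1%:R^-1.

Lemma cut_width_gt0 g k : 0 < cut_width g k.
Proof. by rewrite mulr_gt0 ?invr_gt0// ltr_wpDl// sqr_ge0. Qed.

(** Since [is_G_integral] speaks of every approximating sequence, it can then be applied to one that
    stays away from 0. *)
Lemma step_approx_cut f g : sq_integrable f -> step_approx f g ->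
  step_approx f (fun k => step_cut (cut_width (g k) k) (g k)).
Proof.
move=> fi /(step_approxP _ fi)[gs gf]; apply/step_approxP => //.
split=> [k|]; first exact: is_step_cut.
pose b k := 2 * (2 * k.+1%:R^-1) + 2 * sq_dist (step_fun (g k)) f.
apply: (@squeeze_cvgr _ _ _ _ (fun=> 0) b).
- near=> k; rewrite sq_dist_ge0/=.
  apply: le_trans (sq_dist_triangle _ (sq_integrable_step_fun (g k)) fi) _.
    exact: sq_integrable_step_fun.
  rewrite lerD2r ler_pM2l//; apply: le_trans (sq_dist_cut (cut_width_gt0 _ _) (gs k)) _.
  rewrite /cut_width mulrCA ler_pM2l// mulrA ler_piMl ?invr_ge0//.
  by rewrite ler_pdivrMr ?mul1r ?lerDl// ltr_wpDl// sqr_ge0.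
- exact: cvg_cst.
- rewrite /b -[X in _ --> X]addr0 -{1}(mulr0 2) -{2}(mulr0 2).
  apply: cvgD; apply: cvgM => //; try exact: cvg_cst.
  rewrite -(mulr0 2); apply: cvgM; first exact: cvg_cst.
  exact: cvg_harmonic.
Unshelve. all: by end_near. Qed.

End SquareIntegrable.

(** * The sublinear isometry *)

Section Isometry.
Variables (R : realType) (Omega : Type) (E : sublinear_expectation R Omega).
Variables (sl su : R) (B : R -> Omega -> R).
Hypothesis hs : 0 <= sl <= su.
Hypothesis hB : two_sided_G_Brownian E sl su B.
Local Notation mu := (@lebesgue_measure R).
Local Notation G := (Gfun (sl ^+ 2) (su ^+ 2)).

(* Unlike [is_G_integral], this asks for a single approximating sequence, which
   makes it visibly stable under differences. *)
Definition off_zero_limit (f : R -> R) (I : Omega -> R) := [/\ rv E I, sq_integrable f &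
  exists g, [/\ step_approx f g, forall k, off_zero (g k) &
    (fun k => E (fun w => (step_integral B (g k) w - I w) ^+ 2)) @ \oo --> (0 : R)]].

Lemma two_sided_rv t : rv E (B t).
Proof.
have [B1 [B2 [[r1 _ _] [r2 _ _] _ ->]]] := hB; rewrite /two_sided.
by case: (leP 0 t) => t0; [exact: r1|apply: r2; rewrite oppr_ge0 ltW].
Qed.

Lemma rv_step_integral g : rv E (step_integral B g).
Proof.
by apply: rv_sum => p; apply/rvZ/rvB; exact: two_sided_rv.
Qed.

Lemma rv_sqr X : rv E X -> rv E (fun w => X w ^+ 2).
Proof. by move=> rX; under eq_fun do rewrite expr2; exact: rvM. Qed.

Lemma expect_sqr_ge0 X : rv E X -> 0 <= E (fun w => X w ^+ 2).
Proof.
move=> rX; rewrite -(expect0 E); apply: expect_mono => [||w]; last exact: sqr_ge0.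
  exact: rv_cst.
exact: rv_sqr.
Qed.

Lemma expect_dist_le X Y Z : rv E X -> rv E Y -> rv E Z ->
  (forall w, `|X w - Y w| <= Z w) -> `|E X - E Y| <= E Z.
Proof.
move=> rX rY rZ XY.
have h X' Y' : rv E X' -> rv E Y' -> (forall w, X' w - Y' w <= Z w) -> E X' <= E Y' + E Z.
  move=> rX' rY' le; apply: le_trans (expect_subadd rY' rZ).
  by apply: expect_mono => // [|w]; [exact: rvD|rewrite -lerBlDl].
rewrite ler_norml; apply/andP; split.
  suff : E Y <= E X + E Z by lra.
  apply: h => // w; have := XY w; rewrite distrC => /(le_trans _) -> //; exact: ler_norm.
suff : E X <= E Y + E Z by lra.
by apply: h => // w; apply: le_trans (XY w); exact: ler_norm.
Qed.

Lemma expect_prod_dist (l : R) X Y I J : 0 < l -> rv E X -> rv E Y -> rv E I -> rv E J ->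
  `|E (fun w => X w * Y w) - E (fun w => I w * J w)| <=
   l * E (fun w => I w ^+ 2 + J w ^+ 2) + (l^-1 + 1) *
    (E (fun w => (X w - I w) ^+ 2) + E (fun w => (Y w - J w) ^+ 2)).
Proof.
move=> l0 rX rY rI rJ.
have rdX : rv E (fun w => (X w - I w) ^+ 2) by apply/rv_sqr/rvB.
have rdY : rv E (fun w => (Y w - J w) ^+ 2) by apply/rv_sqr/rvB.
have rS : rv E (fun w => I w ^+ 2 + J w ^+ 2) by apply: rvD; exact: rv_sqr.
have l1 : 0 <= l^-1 + 1 by rewrite addr_ge0// invr_ge0 ltW.
apply: (@le_trans _ _ (E (fun w => l * (I w ^+ 2 + J w ^+ 2) +
    (l^-1 + 1) * ((X w - I w) ^+ 2 + (Y w - J w) ^+ 2)))).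
  apply: expect_dist_le => [|||w]; try exact: rvM.
    by apply: rvD; apply: rvZ => //; exact: rvD.
  exact: norm_prod_diff.
apply: le_trans (expect_subadd _ _) _; try by apply: rvZ => //; exact: rvD.
rewrite !expect_poshom ?(ltW l0)//; last exact: rvD.
by rewrite lerD2l ler_wpM2l// expect_subadd.
Qed.

(** The counterpart of [expect_prod_dist] on the side of the integral; the factor [su ^+ 2] is the
    Lipschitz constant of [G]. *)
Lemma Rintegral_Gfun_dist (l : R) f h f' h' : 0 < l -> sq_integrable f ->
  sq_integrable h -> sq_integrable f' -> sq_integrable h' ->
  `|\int[mu]_x G (f' x * h' x) - \int[mu]_x G (f x * h x)| <=
   l * (su ^+ 2 * \int[mu]_x (f x ^+ 2 + h x ^+ 2)) +
   (l^-1 + 1) * (su ^+ 2 * (sq_dist f' f + sq_dist h' h)).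
Proof.
move=> l0 fi hi fi' hi'.
have v2 : 0 <= sl ^+ 2 <= su ^+ 2.
  have /andP[sl0 slu] := hs.
  by rewrite sqr_ge0 lerXn2r ?nnegrE// (le_trans sl0).
have i1 := sq_integrableM fi hi; have i2 := sq_integrableM fi' hi'.
have g1 := rintegrable_Gfun v2 i1; have g2 := rintegrable_Gfun v2 i2.
have [_ d1] := sq_integrableB fi' fi; have [_ d2] := sq_integrableB hi' hi.
have [_ s1] := fi; have [_ s2] := hi.
have gB : rintegrable (fun x => G (f' x * h' x) - G (f x * h x)).
  have := rintegrableD g2 (rintegrableZ (-1) g1).
  by congr rintegrable; apply/funext => x; rewrite mulN1r.
rewrite -RintegralB//; apply: le_trans (le_normr_Rintegral _ gB) _ => //.
have iS := rintegrableD s1 s2; have iD := rintegrableD d1 d2.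
have -> : l * (su ^+ 2 * \int[mu]_x (f x ^+ 2 + h x ^+ 2)) +
   (l^-1 + 1) * (su ^+ 2 * (sq_dist f' f + sq_dist h' h)) =
   \int[mu]_x (su ^+ 2 * l * (f x ^+ 2 + h x ^+ 2) +
     su ^+ 2 * (l^-1 + 1) * ((f' x - f x) ^+ 2 + (h' x - h x) ^+ 2)).
  rewrite [RHS]RintegralD//; try exact: rintegrableZ.
  rewrite [X in _ = X + _]RintegralZl// [X in _ = _ + X]RintegralZl//.
  rewrite [X in _ = _ + _ * X]RintegralD// /sq_dist; ring.
apply: le_Rintegral => //; first exact: integrable_norm.
  by apply: rintegrableD; exact: rintegrableZ.
move=> x _; apply: le_trans (Gfun_lipschitz _ _ v2) _.
have := ler_wpM2l (sqr_ge0 su) (norm_prod_diff (f' x) (h' x) (f x) (h x) l0).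
by move/le_trans; apply; rewrite le_eqVlt; apply/orP; left; apply/eqP; ring.
Qed.

(** The values [S k] on step functions converge to both sides, by the two distance estimates. *)
Lemma expect_limitM f h I J : off_zero_limit f I -> off_zero_limit h J ->
  E (fun w => I w * J w) = \int[mu]_x G (f x * h x).
Proof.
move=> [rI fi [p [pf p0 pI]]] [rJ hi [q [qh q0 qJ]]].
have /(step_approxP _ fi)[ps pd] := pf; have /(step_approxP _ hi)[qs qd] := qh.
pose S k := E (fun w => step_integral B (p k) w * step_integral B (q k) w).
have dist0 (u : nat -> R) (a : R) : (fun k => u k - a) @ \oo --> (0 : R) -> u @ \oo --> a.
  move=> h0; rewrite -[a]add0r; apply: cvg_trans (cvgD h0 (cvg_cst a)).
  by apply: near_eq_cvg; apply: nearW => k /=; rewrite fctE subrK.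
have SE : S @ \oo --> E (fun w => I w * J w).
  apply: dist0.
  apply: (@cvg0_young _ _ (fun k => E (fun w => (step_integral B (p k) w - I w) ^+ 2) +
     E (fun w => (step_integral B (q k) w - J w) ^+ 2)) (E (fun w => I w ^+ 2 + J w ^+ 2))).
  - rewrite -(expect0 E); apply: expect_mono => [||w]; first exact: rv_cst.
      by apply: rvD; exact: rv_sqr.
    by rewrite addr_ge0// sqr_ge0.
  - by move=> l k l0; apply: expect_prod_dist => //; exact: rv_step_integral.
  - by rewrite -[X in _ --> X]addr0; exact: cvgD.
have SG : S @ \oo --> \int[mu]_x G (f x * h x).
  apply: dist0.
  apply: (@cvg0_young _ _ (fun k => su ^+ 2 *
      (sq_dist (step_fun (p k)) f + sq_dist (step_fun (q k)) h))
    (su ^+ 2 * \int[mu]_x (f x ^+ 2 + h x ^+ 2))).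
  - rewrite mulr_ge0 ?sqr_ge0//; apply: Rintegral_ge0 => x _.
    by rewrite addr_ge0// sqr_ge0.
  - move=> l k l0; rewrite /S (expect_step_integralM hB)//.
    by apply: Rintegral_Gfun_dist => //; exact: sq_integrable_step_fun.
  - rewrite -(mulr0 (su ^+ 2)).
    apply: cvgM; first exact: cvg_cst.
    by rewrite -[X in _ --> X]addr0; exact: cvgD.
exact: (cvg_unique _ SE SG).
Qed.

Lemma off_zero_limitB f I f' I' : off_zero_limit f I -> off_zero_limit f' I' ->
  off_zero_limit (fun x => f x - f' x) (fun w => I w - I' w).
Proof.
move=> [rI fi [p [pf p0 pI]]] [rI' fi' [q [qh q0 qI]]].
have /(step_approxP _ fi)[ps pd] := pf; have /(step_approxP _ fi')[qs qd] := qh.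
have ffi := sq_integrableB fi fi'.
(* Intervals of a step function may overlap, so a difference is a concatenation with negated
   coefficients and needs no common refinement. *)
pose r k : step R := p k ++ [seq (- a.1, a.2) | a <- q k].
have rs k : is_step (r k).
  by rewrite /is_step all_cat all_map; apply/andP; split; [exact: ps|exact: qs].
have rfun k x : step_fun (r k) x = step_fun (p k) x - step_fun (q k) x.
  rewrite /step_fun big_cat big_map/= -sumrN; congr (_ + _).
  by apply: eq_bigr => a _; rewrite mulNr.
have rint k w : step_integral B (r k) w =
    step_integral B (p k) w - step_integral B (q k) w.
  rewrite /step_integral big_cat big_map/= -sumrN; congr (_ + _).
  by apply: eq_bigr => a _; rewrite mulNr.
have lim2 (u u' v : nat -> R) : u @ \oo --> (0 : R) -> u' @ \oo --> (0 : R) ->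
    (forall k, 0 <= v k <= 2 * u k + 2 * u' k) -> v @ \oo --> (0 : R).
  move=> u0 u0' vle; apply: (@squeeze_cvgr _ _ _ _ (fun=> 0) (fun k => 2 * u k + 2 * u' k)).
  - exact: nearW.
  - exact: cvg_cst.
  - rewrite -[X in _ --> X]addr0 -{1}(mulr0 2) -{2}(mulr0 2).
    by apply: cvgD; apply: cvgM => //; exact: cvg_cst.
split=> //; first exact: rvB.
exists r; split=> [|k a|].
- apply/step_approxP => //; split=> //; apply: lim2 pd qd _ => k.
  rewrite sq_dist_ge0/=.
  have [_ d1] := sq_integrableB (sq_integrable_step_fun (p k)) fi.
  have [_ d2] := sq_integrableB (sq_integrable_step_fun (q k)) fi'.
  rewrite /sq_dist -!RintegralZl// -RintegralD//; try exact: rintegrableZ.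
  apply: le_Rintegral => //.
  + by have [] := sq_integrableB (sq_integrable_step_fun (r k)) ffi.
  + by apply: rintegrableD; exact: rintegrableZ.
  move=> x _; rewrite rfun.
  have := sqrD_le (step_fun (p k) x - f x) (- (step_fun (q k) x - f' x)).
  by rewrite sqrrN; apply: le_trans; rewrite le_eqVlt; apply/orP; left; apply/eqP; ring.
- rewrite mem_cat => /orP[/p0//|/mapP[b bq ->]]; exact: q0 bq.
apply: lim2 pI qI _ => k.
have rp : rv E (fun w => step_integral B (p k) w - I w).
  by apply: rvB => //; exact: rv_step_integral.
have rq : rv E (fun w => step_integral B (q k) w - I' w).
  by apply: rvB => //; exact: rv_step_integral.
have rr : rv E (fun w => step_integral B (r k) w - (I w - I' w)).
  by apply: rvB; [exact: rv_step_integral|exact: rvB].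
rewrite expect_sqr_ge0//= -!expect_poshom//; try exact: rv_sqr.
apply: le_trans (expect_subadd (rvZ 2 (rv_sqr rp)) (rvZ 2 (rv_sqr rq))).
apply: expect_mono => [||w]; first exact: rv_sqr.
  by apply: rvD; apply: rvZ; exact: rv_sqr.
rewrite rint.
have := sqrD_le (step_integral B (p k) w - I w) (- (step_integral B (q k) w - I' w)).
by rewrite sqrrN; apply: le_trans; rewrite le_eqVlt; apply/orP; left; apply/eqP; ring.
Qed.

Lemma is_G_integral_limit f I : measurable_fun setT f ->
  is_G_integral E B f I -> off_zero_limit f I.
Proof.
move=> mf [rI [g gf] all_g]; have fi := step_approx_sq_integrable mf gf.
split=> //; have gf' := step_approx_cut fi gf.
exists (fun k => step_cut (cut_width (g k) k) (g k)).
split=> // [k|]; first exact/off_zero_cut/cut_width_gt0.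
(* [L2norm] is a square root, so the limit 0 is multiplied by itself to get convergence of the
   expected squares. *)
have h := all_g _ gf'; rewrite -[X in _ --> X](mulr0 (0 : R)).
apply: cvg_trans (cvgM h h).
apply: near_eq_cvg; apply: nearW => k /=; rewrite /L2norm -expr2.
under eq_fun do rewrite real_normK ?num_real//.
by rewrite sqr_sqrtr// expect_sqr_ge0//; apply: rvB => //; exact: rv_step_integral.
Qed.

End Isometry.

(** * Powers and the fractional kernel *)

Section PowR.
Variable R : realType.
Implicit Types a p x y z : R.

Lemma powR_mvt p x y : 0 < x -> x < y ->
  exists2 c, x < c < y & y `^ p - x `^ p = p * c `^ (p - 1) * (y - x).
Proof.
move=> x0 xy.
have d c : c \in `]x, y[ -> is_derive c 1 (fun u => u `^ p) (p * c `^ (p - 1)).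
  by rewrite in_itv/= => /andP[xc _]; apply: is_derive1_powR; exact: lt_trans xc.
have [|c] := MVT xy d; last by rewrite in_itv/= => cxy e; exists c.
apply: derivable_within_continuous => c; rewrite in_itv/= => /andP[xc _].
by apply: derivable_powR; rewrite in_itv/= andbT (lt_le_trans x0).
Qed.

(** Strict convexity: the mean value theorem on both sides of [x] compares [p * d]^ (p - 1)[with]p *
    c [^ (p - 1)] for some [d < x < c]. *)
Lemma powR_second_diff_gt0 p x : 1 < p -> 1 <= x ->
  0 < (x + 1) `^ p - 2 * x `^ p + (x - 1) `^ p.
Proof.
move=> p1; have p0 : 0 < p by exact: lt_trans p1.
rewrite le_eqVlt => /predU1P[<-|x1].
  rewrite subrr powR0 ?gt_eqF// addr0 powR1 mulr1 subr_gt0 -[1 + 1]/(2 : R).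
  have -> : p = 1 + (p - 1) by ring.
  rewrite powRD ?pnatr_eq0 ?implybT// powRr1// -[ltLHS]mulr1 ltr_pM2l//.
  have : (1 : R) `^ (p - 1) < 2 `^ (p - 1).
    by apply: gt0_ltr_powR; rewrite ?subr_gt0// ?nnegrE ?ler0n// ltr1n.
  by rewrite powR1.
have x0 : 0 < x by exact: lt_trans x1.
have xS : x < x + 1 by rewrite ltrDl.
have xP0 : 0 < x - 1 by rewrite subr_gt0.
have xP : x - 1 < x by rewrite ltrBlDr.
have [c /andP[xc _] e1] := powR_mvt p x0 xS.
have [d /andP[xd dx] e2] := powR_mvt p xP0 xP.
have d0 : 0 < d by exact: lt_trans xd.
have dc : d `^ (p - 1) < c `^ (p - 1).
  have c0 : 0 < c by exact: lt_trans xc.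
  by apply: gt0_ltr_powR; rewrite ?subr_gt0 ?nnegrE ?(ltW d0) ?(ltW c0)//; exact: lt_trans xc.
have -> : (x + 1) `^ p - 2 * x `^ p + (x - 1) `^ p =
  (x + 1) `^ p - x `^ p - (x `^ p - (x - 1) `^ p) by ring.
rewrite e1 e2 subKr addrAC subrr add0r !mulr1 -mulrBr.
by rewrite mulr_gt0// subr_gt0.
Qed.

Lemma powR_le0_anti a x y : a <= 0 -> 0 < x -> x <= y -> y `^ a <= x `^ a.
Proof.
move=> a0 x0 xy; have y0 : 0 < y by exact: lt_le_trans xy.
rewrite -[a]opprK powRN [leRHS]powRN lef_pV2 ?posrE ?powR_gt0//.
by apply: ge0_ler_powR; rewrite ?nnegrE ?oppr_ge0 ?(ltW x0) ?(ltW y0).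
Qed.

(* With [u^a - (u+1)^a = u^a (1 - (1 + 1/u)^a)], both factors decrease in [u]. *)
Lemma powR_diff_anti a z y : a <= 0 -> 0 < z -> z <= y ->
  0 <= y `^ a - (y + 1) `^ a <= z `^ a - (z + 1) `^ a.
Proof.
move=> a0 z0 zy; have y0 : 0 < y by exact: lt_le_trans zy.
have fact u : 0 < u -> u `^ a - (u + 1) `^ a = u `^ a * (1 - (1 + u^-1) `^ a).
  move=> u0; rewrite mulrBr mulr1 -powRM ?(ltW u0)//; last by rewrite addr_ge0// invr_ge0 ltW.
  by rewrite mulrDr mulr1 divff ?gt_eqF.
have le1 u : 0 < u -> 0 <= 1 - (1 + u^-1) `^ a.
  move=> u0; rewrite subr_ge0 -[leRHS]/((fun=> 1 : R) a) -powR1.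
  by apply: powR_le0_anti => //; rewrite lerDl invr_ge0 ltW.
rewrite !fact// mulr_ge0 ?powR_ge0 ?le1//= ler_pM ?powR_ge0 ?le1//.
  exact: powR_le0_anti.
rewrite lerD2l lerN2 powR_le0_anti//; first by rewrite addr_gt0// invr_gt0.
by rewrite lerD2l lef_pV2 ?posrE.
Qed.

Lemma powR_lt0_cvg0 a x : a < 0 -> (fun n => (n%:R - x) `^ a) @ \oo --> (0 : R).
Proof.
move=> a0; apply/cvgrPdist_le => e e0.
near=> n; rewrite sub0r normrN ger0_norm ?powR_ge0//.
have -> : e = (e `^ a^-1) `^ a by rewrite -powRrM mulVf ?lt_eqF// powRr1// ltW.
apply: powR_le0_anti; [exact: ltW|exact: powR_gt0|rewrite lerBrDl].
by near: n; exact: nbhs_infty_ger.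
Unshelve. all: by end_near. Qed.

End PowR.

Section Kernel.
Variables (R : realType) (H : R).

Lemma measurable_pospow a : measurable_fun setT (fun x : R => pospow x a).
Proof.
by rewrite /pospow; apply: measurable_fun_ifT => //; exact: measurable_fun_ltr.
Qed.

Lemma measurable_fBm_kernel t : measurable_fun setT (fBm_kernel H t).
Proof.
apply: measurable_funB; apply: (measurableT_comp (measurable_pospow _)) => //.
by apply: measurable_funB.
Qed.

Lemma pospow_le (a x y : R) : 0 <= a -> x <= y -> pospow x a <= pospow y a.
Proof.
move=> a0 xy; rewrite /pospow; case: ltP => x0; last first.
  by case: ifP => // _; exact: powR_ge0.
have y0 : 0 < y by exact: lt_le_trans xy.
by rewrite y0 ge0_ler_powR ?nnegrE ?(ltW x0) ?(ltW y0).
Qed.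

Lemma fBm_kernel_le s t x : 2^-1 <= H -> s <= t ->
  fBm_kernel H s x <= fBm_kernel H t x.
Proof.
by move=> H2 st; rewrite lerD2r pospow_le ?subr_ge0// lerD2r.
Qed.

Lemma fBm_kernel_ge0 t x : 2^-1 <= H -> 0 <= t -> 0 <= fBm_kernel H t x.
Proof.
move=> H2 t0; have := fBm_kernel_le x H2 t0.
by rewrite {1}/fBm_kernel sub0r subrr.
Qed.

Lemma fBm_kernel_right x t : t <= x -> 0 <= t -> fBm_kernel H t x = 0.
Proof.
move=> tx t0; rewrite /fBm_kernel /pospow !ltNge.
by rewrite subr_le0 tx oppr_le0 (le_trans t0 tx) subrr.
Qed.

Lemma fBm_kernel_increment (s t x : R) : x < s -> x < t ->
  fBm_kernel H t x - fBm_kernel H s x = (t - x) `^ (H - 2^-1) - (s - x) `^ (H - 2^-1).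
Proof.
by move=> xs xt; rewrite /fBm_kernel opprB addrA subrK /pospow !subr_gt0 xs xt.
Qed.

(** The part of the kernel free of [t] cancels, leaving an increment of the power at [n%:R - x],
    whose size decreases in [n]. The range [x < 1] suits the application, where the increment is
    multiplied by [k_1], which vanishes from 1 on. *)
Lemma fBm_kernel_increment_bound (n : nat) (x : R) : H <= 2^-1 -> (1 <= n)%N -> x < 1 ->
  `|fBm_kernel H n.+1%:R x - fBm_kernel H n%:R x| <=
  `|fBm_kernel H 2%:R x - fBm_kernel H 1 x|.
Proof.
move=> H2 n1 x1; have xn : x < n%:R by rewrite (lt_le_trans x1)// ler1n.
rewrite !fBm_kernel_increment//; last 2 first.
- by rewrite (lt_trans x1)// ltr1n.
- by rewrite (lt_trans xn)// ltr_nat.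
have a0 : H - 2^-1 <= 0 by rewrite subr_le0.
have z0 : 0 < 1 - x by rewrite subr_gt0.
have zy : 1 - x <= n%:R - x by rewrite lerD2r ler1n.
have := powR_diff_anti a0 z0 zy; have := powR_diff_anti a0 z0 (lexx _).
have -> : n%:R - x + 1 = n.+1%:R - x by rewrite -natr1 addrAC.
have -> : 1 - x + 1 = 2%:R - x by ring.
move=> /andP[h1 _] /andP[h2 h3].
by rewrite distrC [leRHS]distrC !ger0_norm.
Qed.

Lemma fBm_kernel_increment_cvg0 x : H < 2^-1 ->
  (fun n => (fBm_kernel H n.+1%:R x - fBm_kernel H n%:R x) * fBm_kernel H 1 x)
    @ \oo --> (0 : R).
Proof.
move=> H2; have a0 : H - 2^-1 < 0 by rewrite subr_lt0.
rewrite -[X in _ --> X](mul0r (fBm_kernel H 1 x)).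
apply: cvgM; last exact: cvg_cst.
have h := powR_lt0_cvg0 x a0.
have h1 : (fun n => (n.+1%:R - x) `^ (H - 2^-1)) @ \oo --> (0 : R).
  by have := h; rewrite -(cvg_shiftS (fun n => (n%:R - x) `^ (H - 2^-1))).
rewrite -[X in _ --> X](subrr (0 : R)); apply: cvg_trans (cvgB h1 h).
apply: near_eq_cvg; near=> n => /=.
have xn : x + 1 <= n%:R by near: n; exact: nbhs_infty_ger.
rewrite fBm_kernel_increment//; last by rewrite -natr1; lra.
lra.
Unshelve. all: by end_near. Qed.

End Kernel.

(** * Dominated convergence under [Gfun] *)

Section DominatedConvergence.
Variable R : realType.
Local Notation mu := (@lebesgue_measure R).

Lemma Rintegral_Gfun_cvg0 (vl vu : R) (F : nat -> R -> R) (g : R -> R) :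
  0 <= vl <= vu -> (forall n, measurable_fun setT (F n)) -> rintegrable g ->
  (forall n x, `|F n x| <= g x) -> (forall x, F ^~ x @ \oo --> (0 : R)) ->
  (fun n => \int[mu]_x Gfun vl vu (F n x)) @ \oo --> (0 : R).
Proof.
move=> v mF gi Fg F0; have vu0 : 0 <= vu by case/andP: v => /le_trans; apply.
have m1 n : measurable_fun setT (fun x => (Gfun vl vu (F n x))%:E).
  by apply/measurable_EFinP; exact: measurable_Gfun.
have m2 : measurable_fun setT (cst 0%E : R -> \bar R) by exact: measurable_cst.
have m3 : {ae mu, forall x, setT x -> (fun n => (Gfun vl vu (F n x))%:E) @ \oo --> 0%E}.
  apply: aeW => x _; apply/fine_cvgP; split; first exact: nearW.
  have h : (fun n => vu * `|F n x|) @ \oo --> (0 : R).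
    rewrite -(mulr0 vu); apply: cvgM; first exact: cvg_cst.
    by rewrite -(@normr0 _ R); apply: cvg_norm.
  apply/cvgr0Pnorm_lt => e e0 /=.
  have /cvgr0Pnorm_lt/(_ e e0) := h; apply: filterS => n /=.
  by apply: le_lt_trans; rewrite normrM normr_id (ger0_norm vu0); exact: Gfun_norm_le.
have m4 : mu.-integrable setT (EFin \o (fun x => vu * g x)) by exact: rintegrableZ.
have m5 : {ae mu, forall x n, setT x ->
    (`|(Gfun vl vu (F n x))%:E| <= (EFin \o (fun x => (vu * g x)%R)) x)%E}.
  apply: aeW => x n _; rewrite /= lee_fin; apply: le_trans (Gfun_norm_le _ v) _.
  exact: ler_wpM2l.
have [_ _] := @dominated_convergence _ _ _ mu setT measurableT _ _ _ m1 m2 m3 m4 m5.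
by rewrite integral_cst// mul0e => /fine_cvg.
Qed.

End DominatedConvergence.

(** * The autocorrelations of the increments *)

Theorem theorem3 (R : realType) (Omega : Type)
    (E : sublinear_expectation R Omega) (sl su H : R) (BH : R -> Omega -> R)
    (hs : 0 <= sl <= su) (hH : 0 < H < 1) (hBH : fGBm E sl su H BH) :
  ((2^-1 <= H \/ sl = su) ->
   forall n : nat, (1 <= n)%N ->
     upper_autocorr E BH n =
       2^-1 * su ^+ 2 *
         ((n%:R + 1) `^ (2 * H) - 2 * n%:R `^ (2 * H) + (n%:R - 1) `^ (2 * H)) /\
     lower_autocorr E BH n =
       2^-1 * sl ^+ 2 *
         ((n%:R + 1) `^ (2 * H) - 2 * n%:R `^ (2 * H) + (n%:R - 1) `^ (2 * H)))
  /\
  (2^-1 < H -> 0 < sl < su ->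
   forall n : nat, (1 <= n)%N ->
     0 < lower_autocorr E BH n < upper_autocorr E BH n)
  /\
  (H = 2^-1 ->
   forall n : nat, (1 <= n)%N ->
     upper_autocorr E BH n = 0 /\ lower_autocorr E BH n = 0)
  /\
  (H < 2^-1 ->
   lower_autocorr E BH @ \oo --> (0 : R) /\
   upper_autocorr E BH @ \oo --> (0 : R)).
Proof.
have [_ _ cov [B [hB BI]]] := hBH.
have /andP[sl0 slu] := hs; have su0 : 0 <= su by exact: le_trans slu.
have v2 : 0 <= sl ^+ 2 <= su ^+ 2 by rewrite sqr_ge0 lerXn2r ?nnegrE.
pose k := fBm_kernel H; pose c := C_Hw H ^+ 2.
have c0 : 0 <= c by exact: sqr_ge0.
pose G := Gfun (sl ^+ 2) (su ^+ 2).
pose D n : R := (n%:R + 1) `^ (2 * H) - 2 * n%:R `^ (2 * H) + (n%:R - 1) `^ (2 * H).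
pose Int (f : R -> R) : R := \int[@lebesgue_measure R]_x f x.
have IntB f h : rintegrable f -> rintegrable h ->
    Int (fun x => f x - h x) = Int f - Int h by exact: RintegralB.
have IntZ a f : rintegrable f -> Int (fun x => a * f x) = a * Int f.
  exact: RintegralZl.
have lim t : exists2 I, off_zero_limit E B (k t) I & BH t = fun w => C_Hw H * I w.
  have [I hI BHI] := BI t; exists I; last exact/funext.
  exact: (is_G_integral_limit hB (measurable_fBm_kernel H t)).
have ki t : sq_integrable (k t) by have [I []] := lim t.
have covE s t : E (fun w => BH s w * BH t w) = c * Int (fun x => G (k s x * k t x)).
  have [I lI ->] := lim s; have [J lJ ->] := lim t.
  rewrite /Int -(expect_limitM hs hB lI lJ) -expect_poshom//; last first.
    by apply: rvM; [case: lI|case: lJ].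
  by congr (E _); apply/funext => w; rewrite /c; ring.
have incE s t u : E (fun w => (BH s w - BH t w) * BH u w) =
    c * Int (fun x => G ((k s x - k t x) * k u x)).
  have [I lI ->] := lim s; have [J lJ ->] := lim t; have [L lL ->] := lim u.
  have lIJ := off_zero_limitB hB lI lJ.
  rewrite /Int -(expect_limitM hs hB lIJ lL) -expect_poshom//; last first.
    by apply: rvM; [case: lIJ|case: lL].
  by congr (E _); apply/funext => w; rewrite /c; ring.
have upE n : upper_autocorr E BH n =
    c * Int (fun x => G ((k n.+1%:R x - k n%:R x) * k 1 x)) by exact: incE.
have lowE n : lower_autocorr E BH n =
    - (c * Int (fun x => G ((k n%:R x - k n.+1%:R x) * k 1 x))).
  rewrite -incE /lower_autocorr; congr (- E _); apply/funext => w; ring.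
have formula : (2^-1 <= H \/ sl = su) -> forall n : nat, (1 <= n)%N ->
    upper_autocorr E BH n = 2^-1 * su ^+ 2 * D n /\
    lower_autocorr E BH n = 2^-1 * sl ^+ 2 * D n.
  move=> cond n n1.
  (* The disjunction lists the two situations in which [G] acts linearly: arguments of constant
     sign, or equal slopes. *)
  have Gup x : 0 <= x \/ sl = su -> G x = su ^+ 2 * x.
    by rewrite /G GfunE => -[->//|->]; case: ifP.
  (* The lower autocorrelation evaluates [G] at the opposite of the product, on the branch of slope
     [sl ^+ 2]. *)
  have Glow x y : y = - x -> 0 <= x \/ sl = su -> G y = - (sl ^+ 2 * x).
    move=> ->; rewrite /G GfunE !mulrN => -[x0|->]; last by case: ifP.
    case: ifP => //; rewrite oppr_ge0 => x0'.
    have -> : x = 0 by apply/eqP; rewrite eq_le x0 x0'.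
    by rewrite !mulr0.
  have prod_ge0 t x : 0 <= t -> 0 <= k t x * k 1 x \/ sl = su.
    case: cond => [H2|]; [left|by right].
    by rewrite mulr_ge0// fBm_kernel_ge0.
  have inc_ge0 x : 0 <= (k n.+1%:R x - k n%:R x) * k 1 x \/ sl = su.
    case: cond => [H2|]; [left|by right].
    by rewrite mulr_ge0 ?fBm_kernel_ge0// subr_ge0 fBm_kernel_le// ler_nat.
  pose S t := Int (fun x => k t x * k 1 x).
  have iS t : rintegrable (fun x => k t x * k 1 x) by exact: sq_integrableM.
  have Sinc : Int (fun x => (k n.+1%:R x - k n%:R x) * k 1 x) = S n.+1%:R - S n%:R.
    by rewrite /S -IntB//; congr Int; apply/funext => x; rewrite mulrBl.
  have iinc : rintegrable (fun x => (k n.+1%:R x - k n%:R x) * k 1 x).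
    by apply: sq_integrableM => //; exact: sq_integrableB.
  have upS : upper_autocorr E BH n = su ^+ 2 * (c * (S n.+1%:R - S n%:R)).
    rewrite upE -Sinc mulrCA -(IntZ (su ^+ 2))//; congr (c * Int _).
    by apply/funext => x; exact: Gup.
  have lowS : lower_autocorr E BH n = sl ^+ 2 * (c * (S n.+1%:R - S n%:R)).
    rewrite lowE -Sinc mulrCA -(IntZ (sl ^+ 2))// -mulrN; congr (c * _).
    rewrite -[RHS]opprK; congr (- _); rewrite -mulN1r -(IntZ (-1))//; last first.
      exact: rintegrableZ.
    congr Int; apply/funext => x; rewrite mulN1r; apply: Glow => //; ring.
  (* The covariance determines [c * S t] only after division by [su ^+ 2]; for [su = 0] everything
     vanishes. *)
  have [su00|su_neq0] := eqVneq su 0.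
    have sl00 : sl = 0 by apply/eqP; rewrite eq_le sl0 andbT -su00.
    by rewrite upS lowS su00 sl00 expr0n/= !(mul0r, mulr0).
  have su2 : su ^+ 2 != 0 by rewrite sqrf_eq0.
  have covS t : 0 <= t -> c * S t = 2^-1 * fBm_cov H t 1.
    move=> t0; have [e _] := cov t 1 t0 ler01; rewrite covE in e.
    apply: (mulfI su2); rewrite mulrCA /S -(IntZ (su ^+ 2))//.
    rewrite [RHS]mulrA [su ^+ 2 * _]mulrC -e; congr (c * Int _).
    by apply/funext => x; rewrite Gup//; exact: prod_ge0.
  have -> : 2^-1 * su ^+ 2 * D n = su ^+ 2 * (2^-1 * D n) by ring.
  have -> : 2^-1 * sl ^+ 2 * D n = sl ^+ 2 * (2^-1 * D n) by ring.
  suff eS : c * (S n.+1%:R - S n%:R) = 2^-1 * D n by rewrite upS lowS eS.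
  apply: (etrans (mulrBr _ _ _)).
  have e1 := covS n.+1%:R (ler0n R n.+1); have e2 := covS n%:R (ler0n R n).
  apply: (etrans (congr2 (fun a b => a - b) e1 e2)); rewrite -mulrBr.
  congr (_ * _); rewrite /fBm_cov /D.
  have n1R : 1 <= n%:R :> R by rewrite ler1n.
  rewrite !normr_nat normr1 powR1 [`|1 - n%:R|]distrC [`|1 - n.+1%:R|]distrC.
  rewrite -natr1 addrK normr_nat ger0_norm ?subr_ge0//; ring.
split; [exact: formula|split; [|split]].
- move=> H2 /andP[sl_gt0 slsu] n n1.
  have [-> ->] := formula (or_introl (ltW H2)) n n1.
  have Dn : 0 < D n.
    apply: powR_second_diff_gt0; last by rewrite ler1n.
    by rewrite mulrC -ltr_pdivrMr// mul1r.
  rewrite mulr_gt0 ?mulr_gt0 ?exprn_gt0 ?invr_gt0//=.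
  by rewrite ltr_pM2r// ltr_pM2l ?invr_gt0// ltrXn2r.
- move=> H2 n n1; have H2' : 2^-1 <= H by rewrite H2.
  have [-> ->] := formula (or_introl H2') n n1.
  have -> : D n = 0.
    rewrite /D H2 divff ?pnatr_eq0// !powRr1 ?subr_ge0 ?ler1n ?addr_ge0//; ring.
  by rewrite !mulr0.
- move=> H2.
  have kR x : 1 <= x -> k 1 x = 0 by move=> x1; exact: fBm_kernel_right.
  have mk n m : measurable_fun setT (fun x => (k n x - k m x) * k 1 x).
    by apply: rintegrable_measurable; apply: sq_integrableM => //; exact: sq_integrableB.
  (* The first summand dominates the term [n = 0], where [k 0] is 0 and the increment is [k 1]; the
     second dominates all later terms. *)
  pose g x := `|k 1 x * k 1 x| + `|(k 2%:R x - k 1 x) * k 1 x|.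
  have gi : rintegrable g.
    apply: rintegrableD; apply: integrable_norm => //; first exact: sq_integrableM.
    by apply: sq_integrableM => //; exact: sq_integrableB.
  have k0 x : k 0 x = 0 by rewrite /k /fBm_kernel sub0r subrr.
  have bound n x : `|(k n.+1%:R x - k n%:R x) * k 1 x| <= g x.
    case: n => [|n]; first by rewrite k0 subr0 /g lerDl.
    have [x1|x1] := leP 1 x; first by rewrite /g kR// !mulr0 normr0 addr0.
    apply: (@le_trans _ _ `|(k 2%:R x - k 1 x) * k 1 x|); last by rewrite /g lerDr.
    by rewrite !normrM ler_wpM2r// fBm_kernel_increment_bound// ltW.
  split.
    have -> : lower_autocorr E BH = fun n =>
        - (c * Int (fun x => G ((k n%:R x - k n.+1%:R x) * k 1 x))).
      by apply/funext => n; exact: lowE.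
    rewrite -oppr0; apply: cvgN; rewrite -(mulr0 c); apply: cvgM; first exact: cvg_cst.
    apply: (Rintegral_Gfun_cvg0 v2 _ gi) => // [n x|x].
      by rewrite -opprB mulNr normrN.
    rewrite -oppr0; apply: cvg_trans (cvgN (fBm_kernel_increment_cvg0 x H2)).
    by apply: near_eq_cvg; apply: nearW => n /=; rewrite -mulNr opprB.
  have -> : upper_autocorr E BH = fun n =>
      c * Int (fun x => G ((k n.+1%:R x - k n%:R x) * k 1 x)).
    by apply/funext => n; exact: upE.
  rewrite -(mulr0 c); apply: cvgM; first exact: cvg_cst.
  apply: (Rintegral_Gfun_cvg0 v2 _ gi) => // x.
  exact: fBm_kernel_increment_cvg0.
Qed.
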